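(* Let $\mathcal{E}$ be a globally generated vector bundle of rank $2$ on $Q$ with $c_1(\mathcal{E})=(1,1)$. If $\mathcal{E}$ does not split, then $\mathcal{E}$ is isomorphic to $\mathcal{A}_P:=\phi_P^*(T\mathbb{P}^2(-1))$ for some point $P\in\mathbb{P}^3\setminus Q$, where $\phi_P:Q\to\mathbb{P}^2$ is the linear projection with center $P$.
   Context: The base field is $\mathbb{C}$. $Q\cong\mathbb{P}^1\times\mathbb{P}^1$ is a smooth quadric surface, embedded in $\mathbb{P}^3$ by the Segre map; with $f,g$ the projections to the two factors, $\mathcal{O}_Q(a,b)=f^*\mathcal{O}_{\mathbb{P}^1}(a)\otimes g^*\mathcal{O}_{\mathbb{P}^1}(b)$. A vector bundle $\mathcal{E}$ has $c_1(\mathcal{E})=(a,b)\in\mathbb{Z}^{2}$ if $\det\mathcal{E}\cong\mathcal{O}_Q(a,b)$. A bundle splits if it is a direct sum of line bundles. $T\mathbb{P}^2$ is the tangent bundle of $\mathbb{P}^2$ and $T\mathbb{P}^2(-1)=T\mathbb{P}^2\otimes\mathcal{O}_{\mathbb{P}^2}(-1)$. *)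

(* Defs.v *)
From HB Require Import structures.
From mathcomp Require Import all_boot all_order all_algebra.
From mathcomp Require Import ring.
From mathcomp Require Import mpoly.

Set Implicit Arguments.
Unset Strict Implicit.
Unset Printing Implicit Defensive.

Import GRing.Theory.

Local Open Scope ring_scope.

(* Classical (closed-point) algebraic geometry over an algebraically closed
   field.  A point is given by a nonzero vector of homogeneous coordinates, and
   proportional vectors stand for the same point: open sets and regular
   functions below are automatically invariant under rescaling because they are
   described by homogeneous polynomials. *)
Record hspace (K : closedFieldType) := HSpace {
  hpoint :> Type;
  hdim : nat;
  hcoord : hpoint -> 'rV[K]_hdim;
  hcoord_neq0 : forall x, hcoord x != 0
}.

Definition heval (K : closedFieldType) (X : hspace K)
  (p : {mpoly K[hdim X]}) (x : X) : K := p.@[hcoord x ord0].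

Definition zopen (K : closedFieldType) (X : hspace K) (U : X -> Prop) : Prop :=
  forall x, U x -> exists (d : nat) (q : {mpoly K[hdim X]}),
    [/\ q \is d.-homog, heval q x != 0 & forall y, heval q y != 0 -> U y].

Definition regular (K : closedFieldType) (X : hspace K) (U : X -> Prop)
    (f : X -> K) : Prop :=
  forall x, U x -> exists (d : nat) (p q : {mpoly K[hdim X]}),
    [/\ p \is d.-homog, q \is d.-homog, heval q x != 0
      & forall y, U y -> heval q y != 0 -> f y = heval p y / heval q y].

Definition regular_mx (K : closedFieldType) (X : hspace K) (U : X -> Prop)
    (m n : nat) (A : X -> 'M[K]_(m, n)) : Prop :=
  forall k l, regular U (fun x => A x k l).

Record morphism (K : closedFieldType) (X Y : hspace K) := Morphism {
  mor_fun :> X -> Y;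
  mor_open : forall V : Y -> Prop, zopen V -> zopen (fun x => V (mor_fun x));
  mor_regular : forall (V : Y -> Prop) (f : Y -> K), zopen V -> regular V f ->
    regular (fun x => V (mor_fun x)) (fun x => f (mor_fun x))
}.

(* An algebraic vector bundle of rank r, given by regular transition functions
   on an open cover.  If s_i denotes the column of coordinates of a local
   section in the i-th trivialization, then s_i = (vtrans i j) *m s_j. *)
Record vbundle (K : closedFieldType) (X : hspace K) (r : nat) := VBundle {
  vidx : Type;
  vdom : vidx -> X -> Prop;
  vtrans : vidx -> vidx -> X -> 'M[K]_r;
  vdom_open : forall i, zopen (vdom i);
  vdom_cover : forall x, exists i, vdom i x;
  vtrans_regular : forall i j,
    regular_mx (fun x => vdom i x /\ vdom j x) (vtrans i j);
  vtrans_id : forall i x, vdom i x -> vtrans i i x = 1%:M;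
  vtrans_cocycle : forall i j k x, vdom i x -> vdom j x -> vdom k x ->
    vtrans i j x *m vtrans j k x = vtrans i k x
}.

Arguments mor_open {K X Y} m V.
Arguments vdom {K X r} v i x.
Arguments vtrans {K X r} v i j x.
Arguments vdom_open {K X r} v i x.
Arguments vtrans_cocycle {K X r} v i j k x.
Arguments vdom_cover {K X r} v x.
Arguments vtrans_regular {K X r} v i j.

Definition vhom (K : closedFieldType) (X : hspace K) (r s : nat)
    (E : vbundle X r) (F : vbundle X s)
    (h : vidx F -> vidx E -> X -> 'M[K]_(s, r)) : Prop :=
  (forall a i, regular_mx (fun x => vdom F a x /\ vdom E i x) (h a i)) /\
  (forall a b i j x, vdom F a x -> vdom F b x -> vdom E i x -> vdom E j x ->
     vtrans F a b x *m h b j x = h a i x *m vtrans E i j x).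

Definition visom (K : closedFieldType) (X : hspace K) (r s : nat)
    (E : vbundle X r) (F : vbundle X s) : Prop :=
  exists h k, [/\ vhom (E := E) (F := F) h, vhom (E := F) (F := E) k
    & forall a i x, vdom F a x -> vdom E i x ->
        h a i x *m k i a x = 1%:M /\ k i a x *m h a i x = 1%:M].

Definition global_section (K : closedFieldType) (X : hspace K) (r : nat)
    (E : vbundle X r) (s : vidx E -> X -> 'cV[K]_r) : Prop :=
  (forall i, regular_mx (vdom E i) (s i)) /\
  (forall i j x, vdom E i x -> vdom E j x -> s i x = vtrans E i j x *m s j x).

(* The evaluation map from global sections to the fibre is onto at each point. *)
Definition globally_generated (K : closedFieldType) (X : hspace K) (r : nat)
    (E : vbundle X r) : Prop :=
  forall (x : X) (i : vidx E), vdom E i x -> forall v : 'cV[K]_r,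
    exists2 s, global_section (E := E) s & s i x = v.

Lemma zopenT (K : closedFieldType) (X : hspace K) : zopen (fun _ : X => True).
Proof.
move=> x _; exists 0%N, 1; split=> //; first exact: dhomog1.
by rewrite /heval meval1 oner_neq0.
Qed.

Lemma zopenI (K : closedFieldType) (X : hspace K) (U V : X -> Prop) :
  zopen U -> zopen V -> zopen (fun x => U x /\ V x).
Proof.
move=> oU oV x [Ux Vx].
have [d [p [hp px pU]]] := oU x Ux; have [e [q [hq qx qV]]] := oV x Vx.
exists (d + e)%N, (p * q); split; first exact: dhomogM.
  by rewrite /heval mevalM mulf_neq0.
move=> y; rewrite /heval mevalM mulf_eq0 negb_or => /andP[py qy].
by split; [apply: pU | apply: qV].
Qed.

Lemma regular_sub (K : closedFieldType) (X : hspace K) (U V : X -> Prop) f :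
  (forall x, V x -> U x) -> regular U f -> regular V f.
Proof.
move=> VU rf x Vx; have [d [p [q [hp hq qx fE]]]] := rf x (VU x Vx).
by exists d, p, q; split=> // y Vy; apply: fE; apply: VU.
Qed.

Lemma regular_ext (K : closedFieldType) (X : hspace K) (U : X -> Prop) f g :
  (forall x, U x -> f x = g x) -> regular U f -> regular U g.
Proof.
move=> fg rf x Ux; have [d [p [q [hp hq qx fE]]]] := rf x Ux.
by exists d, p, q; split=> // y Uy qy; rewrite -fg // fE.
Qed.

Lemma regular_const (K : closedFieldType) (X : hspace K) (U : X -> Prop) c :
  regular U (fun=> c).
Proof.
move=> x _; exists 0%N, (c *: 1), 1; split.
- by apply: dhomogZ; apply: dhomog1.
- exact: dhomog1.
- by rewrite /heval meval1 oner_neq0.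
by move=> y _ _; rewrite /heval mevalZ meval1 divr1 mulr1.
Qed.

Lemma regularD (K : closedFieldType) (X : hspace K) (U : X -> Prop) f g :
  regular U f -> regular U g -> regular U (fun x => f x + g x).
Proof.
move=> rf rg x Ux.
have [d [p [q [hp hq qx fE]]]] := rf x Ux.
have [e [p' [q' [hp' hq' qx' gE]]]] := rg x Ux.
exists (d + e)%N, (p * q' + q * p'), (q * q'); split.
- by apply: dhomogD; apply: dhomogM.
- exact: dhomogM.
- by rewrite /heval mevalM mulf_neq0.
move=> y Uy; rewrite /heval !(mevalM, mevalD) mulf_eq0 negb_or => /andP[qy qy'].
by rewrite fE // gE // /heval; field; rewrite qy qy'.
Qed.

Lemma regularM (K : closedFieldType) (X : hspace K) (U : X -> Prop) f g :
  regular U f -> regular U g -> regular U (fun x => f x * g x).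
Proof.
move=> rf rg x Ux.
have [d [p [q [hp hq qx fE]]]] := rf x Ux.
have [e [p' [q' [hp' hq' qx' gE]]]] := rg x Ux.
exists (d + e)%N, (p * p'), (q * q'); split; try exact: dhomogM.
  by rewrite /heval mevalM mulf_neq0.
move=> y Uy; rewrite /heval !mevalM mulf_eq0 negb_or => /andP[qy qy'].
by rewrite fE // gE // mulf_div.
Qed.

Lemma regularV (K : closedFieldType) (X : hspace K) (U : X -> Prop) f :
  (forall x, U x -> f x != 0) -> regular U f -> regular U (fun x => (f x)^-1).
Proof.
move=> f0 rf x Ux; have [d [p [q [hp hq qx fE]]]] := rf x Ux.
have px : heval p x != 0.
  by move: (f0 x Ux); rewrite fE // mulf_eq0 negb_or => /andP[].
exists (d + d)%N, (q * q), (p * q); split; try exact: dhomogM.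
  by rewrite /heval mevalM mulf_neq0.
move=> y Uy; rewrite /heval !mevalM mulf_eq0 negb_or => /andP[py qy].
by rewrite fE // invf_div -mulf_div divff // mulr1.
Qed.

Lemma regular_exp (K : closedFieldType) (X : hspace K) (U : X -> Prop) f n :
  regular U f -> regular U (fun x => f x ^+ n).
Proof.
move=> rf; elim: n => [|n IHn]; first exact: regular_const.
apply: (regular_ext (f := fun x => f x * f x ^+ n)); last exact: regularM.
by move=> x _; rewrite exprS.
Qed.

Lemma regular_sum (K : closedFieldType) (X : hspace K) (U : X -> Prop)
    (I : Type) (s : seq I) (P : pred I) (f : I -> X -> K) :
  (forall i, regular U (f i)) -> regular U (fun x => \sum_(i <- s | P i) f i x).
Proof.
move=> rf; elim: s => [|i s IHs].
  apply: (regular_ext (f := fun=> 0)); last exact: regular_const.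
  by move=> x _; rewrite big_nil.
apply: (regular_ext (f := fun x => (if P i then f i x else 0) +
                              \sum_(j <- s | P j) f j x)).
  by move=> x _; rewrite big_cons; case: (P i); rewrite ?add0r.
by apply: regularD => //; case: (P i); [apply: rf | apply: regular_const].
Qed.

Lemma regular_prod (K : closedFieldType) (X : hspace K) (U : X -> Prop)
    (I : Type) (s : seq I) (P : pred I) (f : I -> X -> K) :
  (forall i, regular U (f i)) -> regular U (fun x => \prod_(i <- s | P i) f i x).
Proof.
move=> rf; elim: s => [|i s IHs].
  apply: (regular_ext (f := fun=> 1)); last exact: regular_const.
  by move=> x _; rewrite big_nil.
apply: (regular_ext (f := fun x => (if P i then f i x else 1) *
                              \prod_(j <- s | P j) f j x)).
  by move=> x _; rewrite big_cons; case: (P i); rewrite ?mul1r.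
by apply: regularM => //; case: (P i); [apply: rf | apply: regular_const].
Qed.

Lemma regular_det (K : closedFieldType) (X : hspace K) (U : X -> Prop)
    (n : nat) (A : X -> 'M[K]_n) :
  regular_mx U A -> regular U (fun x => \det (A x)).
Proof.
move=> rA; apply: regular_sum => s; apply: regularM; first exact: regular_const.
by apply: regular_prod => i; apply: rA.
Qed.

Lemma regular_ratio (K : closedFieldType) (X : hspace K) (i j : 'I_(hdim X)) :
  regular (fun x : X => hcoord x ord0 j != 0)
          (fun x => hcoord x ord0 i / hcoord x ord0 j).
Proof.
move=> x xj; exists 1%N, 'X_i, 'X_j.
by split; rewrite ?dhomogX /= ?mdeg1 // /heval ?mevalXU // => y; rewrite !mevalXU.
Qed.

Lemma dhomog_bigprod (K : closedFieldType) (n : nat) (I : Type) (s : seq I)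
    (D : I -> nat) (F : I -> {mpoly K[n]}) :
  (forall i, F i \is (D i).-homog) ->
  \prod_(i <- s) F i \is (\sum_(i <- s) D i).-homog.
Proof.
move=> hF; elim: s => [|i s IHs]; first by rewrite !big_nil dhomog1.
by rewrite !big_cons dhomogM.
Qed.

Lemma dhomog_comp (K : closedFieldType) (m n d e : nat)
    (p : {mpoly K[m]}) (F : m.-tuple {mpoly K[n]}) :
  p \is d.-homog -> (forall k, tnth F k \is e.-homog) ->
  p \mPo F \is (d * e).-homog.
Proof.
move=> hp hF; rewrite comp_mpolyEX big_seq; apply: rpred_sum => c cp.
apply: dhomogZ; rewrite comp_mpolyX.
have <- : (\sum_(i < m) e * c i)%N = (d * e)%N.
  by rewrite -big_distrr /= -mdegE; have /= -> := dhomog_mf hp cp; rewrite mulnC.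
by apply: dhomog_bigprod => i; apply: dhomogMn.
Qed.

Lemma dhomog_scale (K : closedFieldType) (n d : nat) (p : {mpoly K[n]})
    (c : K) (v w : 'I_n -> K) :
  p \is d.-homog -> (forall k, w k = c * v k) -> p.@[w] = c ^+ d * p.@[v].
Proof.
move=> hp wE; rewrite !mevalE big_distrr /= !big_seq; apply: eq_bigr => m mp.
rewrite mulrCA; congr (_ * _); have /= <- := dhomog_mf hp mp; rewrite mdegE -prodrXr.
by rewrite -big_split; apply: eq_bigr => i _; rewrite wE exprMn.
Qed.

Definition locally_polynomial (K : closedFieldType) (X Y : hspace K)
    (phi : X -> Y) : Prop :=
  forall x : X, exists (e : nat) (F : (hdim Y).-tuple {mpoly K[hdim X]})
      (c : X -> K),
    [/\ forall k, tnth F k \is e.-homog, c x != 0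
      & forall y k, heval (tnth F k) y = c y * hcoord (phi y) ord0 k].

Lemma locally_polynomial_open (K : closedFieldType) (X Y : hspace K)
    (phi : X -> Y) (V : Y -> Prop) :
  locally_polynomial phi -> zopen V -> zopen (fun x => V (phi x)).
Proof.
move=> phiP oV x Vx; have [d [q [hq qx qV]]] := oV _ Vx.
have [e [F [c [hF cx FE]]]] := phiP x.
have qFE y : heval (q \mPo F) y = c y ^+ d * heval q (phi y).
  by rewrite /heval comp_mpoly_meval; apply: dhomog_scale => // k; apply: FE.
exists (d * e)%N, (q \mPo F); split; first exact: dhomog_comp.
  by rewrite qFE mulf_neq0 // expf_neq0.
by move=> y; rewrite qFE mulf_eq0 negb_or => /andP[_]; apply: qV.
Qed.

Lemma locally_polynomial_regular (K : closedFieldType) (X Y : hspace K)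
    (phi : X -> Y) (V : Y -> Prop) (f : Y -> K) :
  locally_polynomial phi -> regular V f -> regular (fun x => V (phi x)) (fun x => f (phi x)).
Proof.
move=> phiP rf x Vx; have [d [p [q [hp hq qx fE]]]] := rf _ Vx.
have [e [F [c [hF cx FE]]]] := phiP x.
have FE' (r : {mpoly K[hdim Y]}) y : r \is d.-homog ->
    heval (r \mPo F) y = c y ^+ d * heval r (phi y).
  by rewrite /heval comp_mpoly_meval => hr; apply: dhomog_scale => // k; apply: FE.
exists (d * e)%N, (p \mPo F), (q \mPo F); split; try exact: dhomog_comp.
  by rewrite FE' // mulf_neq0 // expf_neq0.
move=> y Vy; rewrite !FE' // mulf_eq0 negb_or => /andP[cy qy].
by rewrite fE // -mulf_div divff // mul1r.
Qed.

Definition morphism_of_polynomials (K : closedFieldType) (X Y : hspace K)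
    (phi : X -> Y)
    (phiP : locally_polynomial phi) : morphism X Y :=
  Morphism (fun V => @locally_polynomial_open K X Y phi V phiP)
           (fun V f _ => @locally_polynomial_regular K X Y phi V f phiP).

Lemma regular_pull (K : closedFieldType) (X Y : hspace K) (phi : morphism X Y)
    (r : nat) (E : vbundle Y r) (i j : vidx E) :
  regular_mx (fun x => vdom E i (phi x) /\ vdom E j (phi x))
             (fun x => vtrans E i j (phi x)).
Proof.
move=> k l; apply: (mor_regular (V := fun y => vdom E i y /\ vdom E j y)
                                (f := fun y => vtrans E i j y k l)).
  by apply: zopenI; apply: vdom_open.
exact: vtrans_regular.
Qed.

Definition vpull (K : closedFieldType) (X Y : hspace K) (phi : morphism X Y)
    (r : nat) (E : vbundle Y r) : vbundle X r :=
  @VBundle K X r (vidx E)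
    (fun i x => vdom E i (phi x)) (fun i j x => vtrans E i j (phi x))
    (fun i => mor_open phi _ (vdom_open E i))
    (fun x => vdom_cover E (phi x))
    (@regular_pull K X Y phi r E)
    (fun i x => @vtrans_id K Y r E i (phi x))
    (fun i j k x => @vtrans_cocycle K Y r E i j k (phi x)).

Definition vdet (K : closedFieldType) (X : hspace K) (r : nat)
  (E : vbundle X r) : vbundle X 1.
Proof.
refine (@VBundle K X 1 (vidx E) (vdom E) (fun i j x => (\det (vtrans E i j x))%:M)
          (vdom_open E) (vdom_cover E) _ _ _).
- move=> i j k l.
  apply: (regular_ext (f := fun x => \det (vtrans E i j x))).
    by move=> x _; rewrite !ord1 mxE eqxx mulr1n.
  exact/regular_det/vtrans_regular.
- by move=> i x ix; rewrite vtrans_id // det1.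
- by move=> i j k x ix jx kx; rewrite -scalar_mxM -det_mulmx vtrans_cocycle.
Defined.

(* The tensor product of E with L: transition functions in rank one are scalars. *)
Definition vtwist (K : closedFieldType) (X : hspace K) (r : nat)
  (E : vbundle X r) (L : vbundle X 1) : vbundle X r.
Proof.
refine (@VBundle K X r (vidx E * vidx L)%type
          (fun a x => vdom E a.1 x /\ vdom L a.2 x)
          (fun a b x => vtrans L a.2 b.2 x ord0 ord0 *: vtrans E a.1 b.1 x)
          _ _ _ _ _).
- by move=> a; apply: zopenI; [exact: (vdom_open E)|exact: vdom_open].
- move=> x; have [i ix] := vdom_cover E x; have [l lx] := vdom_cover L x.
  by exists (i, l).
- move=> a b k l.
  apply: (regular_ext (f := fun x =>
      vtrans L a.2 b.2 x ord0 ord0 * vtrans E a.1 b.1 x k l)).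
    by move=> x _; rewrite mxE.
  apply: regularM; [apply: regular_sub (vtrans_regular L _ _ _ _)
                   |apply: regular_sub (vtrans_regular E _ _ _ _)];
  by move=> x [[? ?] [? ?]].
- by move=> a x [? ?]; rewrite !vtrans_id // mxE eqxx scale1r.
- move=> a b c x [? ?] [? ?] [? ?].
  rewrite -scalemxAl -scalemxAr scalerA vtrans_cocycle //.
  by rewrite -(vtrans_cocycle L a.2 b.2 c.2) // mxE big_ord1.
Defined.

Definition vsum (K : closedFieldType) (X : hspace K) (r s : nat)
  (E : vbundle X r) (F : vbundle X s) : vbundle X (r + s).
Proof.
refine (@VBundle K X (r + s) (vidx E * vidx F)%type
          (fun a x => vdom E a.1 x /\ vdom F a.2 x)
          (fun a b x => block_mx (vtrans E a.1 b.1 x) 0 0 (vtrans F a.2 b.2 x))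
          _ _ _ _ _).
- by move=> a; apply: zopenI; [exact: (vdom_open E)|exact: vdom_open].
- move=> x; have [i ix] := vdom_cover E x; have [l lx] := vdom_cover F x.
  by exists (i, l).
- move=> a b k l; rewrite -(splitK k) -(splitK l).
  case: (split k) => k'; case: (split l) => l' /=.
  + apply: (regular_ext (f := fun x => vtrans E a.1 b.1 x k' l')).
      by move=> x _; rewrite block_mxEul.
    by apply: regular_sub (vtrans_regular E _ _ _ _) => x [[? ?] [? ?]].
  + apply: (regular_ext (f := fun=> 0)); last exact: regular_const.
    by move=> x _; rewrite block_mxEur mxE.
  + apply: (regular_ext (f := fun=> 0)); last exact: regular_const.
    by move=> x _; rewrite block_mxEdl mxE.
  + apply: (regular_ext (f := fun x => vtrans F a.2 b.2 x k' l')).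
      by move=> x _; rewrite block_mxEdr.
    by apply: regular_sub (vtrans_regular F _ _ _ _) => x [[? ?] [? ?]].
- by move=> a x [? ?]; rewrite !vtrans_id // -scalar_mx_block.
- move=> a b c x [? ?] [? ?] [? ?].
  by rewrite mulmx_block !mulmx0 !mul0mx !addr0 !add0r !vtrans_cocycle.
Defined.

Definition splits (K : closedFieldType) (X : hspace K) (E : vbundle X 2) : Prop :=
  exists L M : vbundle X 1, visom E (vsum L M).

Definition pspace (K : closedFieldType) (n : nat) : hspace K :=
  @HSpace K {v : 'rV[K]_n.+1 | v != 0} n.+1 (fun x => val x) (fun x => valP x).

Lemma pspace_open (K : closedFieldType) (n : nat) (i : 'I_n.+1) :
  zopen (fun x : pspace K n => hcoord x ord0 i != 0).
Proof.
move=> x xi; exists 1%N, 'X_i.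
by split; rewrite ?dhomogX /= ?mdeg1 // /heval ?mevalXU // => y; rewrite mevalXU.
Qed.

Lemma pspace_cover (K : closedFieldType) (n : nat) (x : pspace K n) :
  exists i, hcoord x ord0 i != 0.
Proof.
apply/existsP; apply: contraNT (hcoord_neq0 x); rewrite negb_exists.
by move=> /forallP x0; apply/eqP/rowP => i; rewrite mxE; apply/eqP/negPn/x0.
Qed.

(* O(a): on the chart x_i <> 0 a section given by a homogeneous function F of
   degree a has the coordinate F / x_i ^ a. *)
Definition pline (K : closedFieldType) (n : nat) (a : int) :
  vbundle (pspace K n) 1.
Proof.
refine (@VBundle K (pspace K n) 1 'I_n.+1
          (fun i x => hcoord x ord0 i != 0)
          (fun i j x => ((hcoord x ord0 j / hcoord x ord0 i) ^ a)%:M)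
          (@pspace_open K n) (@pspace_cover K n) _ _ _).
- move=> i j k l.
  pose f (x : pspace K n) := hcoord x ord0 j / hcoord x ord0 i.
  apply: (regular_ext (f := fun x => f x ^ a)).
    by move=> x _; rewrite !ord1 mxE eqxx mulr1n.
  have rf : regular (fun x : pspace K n =>
      hcoord x ord0 i != 0 /\ hcoord x ord0 j != 0) f.
    by apply: regular_sub (@regular_ratio K (pspace K n) j i) => x [].
  case: a => m; first exact: regular_exp.
  apply: regularV; last exact: regular_exp.
  by move=> x [xi xj]; rewrite expf_neq0 // mulf_neq0 // invr_eq0.
- by move=> i x xi; rewrite divff // exp1rz.
- move=> i j k x xi xj xk; rewrite -scalar_mxM -expfzMl; congr (_ ^ _)%:M.
  by field; rewrite xi xj.
Defined.

(* Value at v of the partial derivative with respect to the l-th variable of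
   the rational function p / q, by the quotient rule. *)
Definition pderiv (K : fieldType) (n : nat) (p q : {mpoly K[n]}) (l : 'I_n)
    (v : 'rV[K]_n) : K :=
  ((p^`M(l)).@[v ord0] * q.@[v ord0] - p.@[v ord0] * (q^`M(l)).@[v ord0])
    / q.@[v ord0] ^+ 2.

(* On the chart x_i <> 0 the affine coordinates are the x_k / x_i for k <> i;
   the change of coordinates from chart j to chart i expresses them as rational
   functions of the x_l with l <> j, the representative of the point being
   normalized by x_j = 1.  Tangent vectors transform by its Jacobian matrix. *)
Definition pjacobian (K : closedFieldType) (n : nat) (i j : 'I_n.+1)
    (x : pspace K n) : 'M[K]_n :=
  \matrix_(k, l) pderiv 'X_(lift i k) 'X_i (lift j l)
                   ((hcoord x ord0 j)^-1 *: hcoord x).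

Lemma pjacobianE (K : closedFieldType) (n : nat) (i j : 'I_n.+1)
    (x : pspace K n) k l :
  hcoord x ord0 i != 0 -> hcoord x ord0 j != 0 ->
  pjacobian i j x k l = hcoord x ord0 j / hcoord x ord0 i *
    ((lift i k == lift j l)%:R
     - hcoord x ord0 (lift i k) / hcoord x ord0 i * (i == lift j l)%:R).
Proof.
move=> xi xj; rewrite mxE /pderiv !mevalXU !mxE.
have dX (m m' : 'I_n.+1) v : (('X_m : {mpoly K[n.+1]})^`M(m')).@[v] = (m == m')%:R.
  rewrite mderivX mnm1E; case: eqP => [->|_]; last by rewrite scale0r meval0.
  rewrite scale1r; have -> : (U_(m') - U_(m') = 0)%MM.
    by apply/mnmP => t; rewrite mnmBE subnn mnm0E.
  by rewrite mpolyX0 meval1.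
by rewrite !dX; field; rewrite xi xj.
Qed.

Definition ptangent (K : closedFieldType) (n : nat) : vbundle (pspace K n) n.
Proof.
refine (@VBundle K (pspace K n) n 'I_n.+1
          (fun i x => hcoord x ord0 i != 0) (@pjacobian K n)
          (@pspace_open K n) (@pspace_cover K n) _ _ _).
- move=> i j k l.
  pose f (m m' : 'I_n.+1) (x : pspace K n) := hcoord x ord0 m / hcoord x ord0 m'.
  apply: (regular_ext (f := fun x => f j i x * ((lift i k == lift j l)%:R
     + f (lift i k) i x * - (i == lift j l)%:R))).
    by move=> x [xi xj]; rewrite pjacobianE // mulrN.
  have rf m : regular (fun x : pspace K n =>
      hcoord x ord0 i != 0 /\ hcoord x ord0 j != 0) (f m i).
    by apply: regular_sub (@regular_ratio K (pspace K n) m i) => x [].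
  apply: regularM => //; apply: regularD; first exact: regular_const.
  by apply: regularM => //; apply: regular_const.
- move=> i x xi; apply/matrixP => k l; rewrite pjacobianE // mxE divff //.
  by rewrite (negPf (neq_lift i l)) mulr0 subr0 mul1r (inj_eq lift_inj).
- move=> i j m x xi xj xm; apply/matrixP => k l; rewrite mxE [RHS]pjacobianE //.
  set y := hcoord x ord0; set kk := lift i k; set ll := lift m l.
  pose F (t : 'I_n.+1) := (y j / y i * ((kk == t)%:R - y kk / y i * (i == t)%:R)) *
    (y m / y j * ((t == ll)%:R - y t / y j * (j == ll)%:R)).
  transitivity (\sum_t F t).
    rewrite (bigD1_ord j) //= [F j]/F divff // mul1r subrr !mulr0 add0r.
    by apply: eq_bigr => t _; rewrite !pjacobianE.
  have dsum (a : 'I_n.+1) (G : 'I_n.+1 -> K) : \sum_t (a == t)%:R * G t = G a.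
    rewrite (bigD1 a) //= eqxx mul1r big1 ?addr0 // => t ta.
    by rewrite eq_sym (negPf ta) mul0r.
  pose G t := y m / y i * ((t == ll)%:R - y t / y j * (j == ll)%:R).
  transitivity (\sum_t (kk == t)%:R * G t - y kk / y i * \sum_t (i == t)%:R * G t).
    rewrite big_distrr /= -sumrB; apply: eq_bigr => t _.
    by rewrite /F /G; field; rewrite xi xj.
  by rewrite !dsum /G; field; rewrite xi xj.
Defined.

Lemma segre_neq0 (K : closedFieldType) (x : pspace K 1 * pspace K 1) :
  mxvec ((hcoord x.1)^T *m hcoord x.2) != 0.
Proof.
have [i xi] := pspace_cover x.1; have [j xj] := pspace_cover x.2.
apply/eqP => /rowP/(_ (mxvec_index i j)); rewrite mxvecE !mxE big_ord1 mxE.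
by move/eqP; rewrite mulf_eq0 (negPf xi) (negPf xj).
Qed.

(* P^1 x P^1 with the homogeneous coordinates s_i t_j of the Segre embedding in
   P^3; since 2 * 2 = 4 these are the coordinates of a point of [pspace K 3]. *)
Definition quadric (K : closedFieldType) : hspace K :=
  @HSpace K (pspace K 1 * pspace K 1)%type (2 * 2)
    (fun x => mxvec ((hcoord x.1)^T *m hcoord x.2)) (@segre_neq0 K).

Lemma quadric_coord (K : closedFieldType) (x : quadric K) i j :
  hcoord x ord0 (mxvec_index i j) = hcoord x.1 ord0 i * hcoord x.2 ord0 j.
Proof. by rewrite /= mxvecE !mxE big_ord1 mxE. Qed.

Lemma quadric_fst_poly (K : closedFieldType) :
  locally_polynomial (fun x : quadric K => x.1 : pspace K 1).
Proof.
move=> x; have [j xj] := pspace_cover x.2.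
exists 1%N, [tuple 'X_(mxvec_index k j) | k < 2], (fun y => hcoord y.2 ord0 j).
split=> // [k|y k]; rewrite tnth_mktuple; first by rewrite dhomogX /= mdeg1.
by rewrite /heval mevalXU quadric_coord mulrC.
Qed.

Lemma quadric_snd_poly (K : closedFieldType) :
  locally_polynomial (fun x : quadric K => x.2 : pspace K 1).
Proof.
move=> x; have [i xi] := pspace_cover x.1.
exists 1%N, [tuple 'X_(mxvec_index i k) | k < 2], (fun y => hcoord y.1 ord0 i).
split=> // [k|y k]; rewrite tnth_mktuple; first by rewrite dhomogX /= mdeg1.
by rewrite /heval mevalXU quadric_coord.
Qed.

Definition quadric_fst (K : closedFieldType) : morphism (quadric K) (pspace K 1) :=
  morphism_of_polynomials (@quadric_fst_poly K).

Definition quadric_snd (K : closedFieldType) : morphism (quadric K) (pspace K 1) :=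
  morphism_of_polynomials (@quadric_snd_poly K).

Definition quadric_line (K : closedFieldType) (a b : int) :
    vbundle (quadric K) 1 :=
  vtwist (vpull (quadric_fst K) (pline K 1 a)) (vpull (quadric_snd K) (pline K 1 b)).

Definition has_c1 (K : closedFieldType) (r : nat) (E : vbundle (quadric K) r)
    (a b : int) : Prop :=
  visom (vdet E) (quadric_line K a b).

Definition off_quadric (K : closedFieldType) (P : pspace K 3) : Prop :=
  forall (x : quadric K) (c : K), hcoord x <> c *: hcoord P.

(* The line joining x and P meets the plane of equation [pivot P] = 0 at the
   point P_i x - x_i P, i being [pivot P]; the remaining three coordinates
   identify this plane with P^2. *)
Definition pivot (K : closedFieldType) (P : pspace K 3) : 'I_4 :=
  xchoose (pspace_cover P).

Definition proj_coord (K : closedFieldType) (P : pspace K 3) (v : 'rV[K]_4) :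
    'rV[K]_3 :=
  \row_k (hcoord P ord0 (pivot P) * v ord0 (lift (pivot P) k)
          - v ord0 (pivot P) * hcoord P ord0 (lift (pivot P) k)).

Lemma proj_coord_neq0 (K : closedFieldType) (P : pspace K 3)
    (offP : off_quadric P) (x : quadric K) : proj_coord P (hcoord x) != 0.
Proof.
have Pi : hcoord P ord0 (pivot P) != 0 := xchooseP (pspace_cover P).
apply/eqP => /rowP x0.
apply: (offP x ((hcoord x : 'rV_4) ord0 (pivot P) / hcoord P ord0 (pivot P))).
apply/rowP => m; rewrite [RHS]mxE.
case: (unliftP (pivot P) m) => [k ->|->]; last by rewrite divfK.
have /eqP := x0 k; rewrite !mxE subr_eq0 => /eqP xE.
by apply: (mulfI Pi); rewrite [LHS]xE mulrA mulrCA divff // mulr1.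
Qed.

Definition proj_fun (K : closedFieldType) (P : pspace K 3)
    (offP : off_quadric P) (x : quadric K) : pspace K 2 :=
  exist _ (proj_coord P (hcoord x)) (proj_coord_neq0 offP x).

Lemma proj_poly (K : closedFieldType) (P : pspace K 3) (offP : off_quadric P) :
  locally_polynomial (proj_fun offP).
Proof.
move=> x.
pose F (k : 'I_3) : {mpoly K[4]} :=
  hcoord P ord0 (pivot P) *: 'X_(lift (pivot P) k)
  - hcoord P ord0 (lift (pivot P) k) *: 'X_(pivot P).
exists 1%N, [tuple F k | k < 3], (fun=> 1); split.
- move=> k; rewrite tnth_mktuple; apply: rpredB; apply: dhomogZ;
  by rewrite dhomogX /= mdeg1.
- exact: oner_neq0.
move=> y k; rewrite tnth_mktuple /heval /F mevalB !mevalZ !mevalXU mul1r.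
by rewrite [RHS]mxE; congr (_ - _); rewrite mulrC.
Qed.

Definition quadric_proj (K : closedFieldType) (P : pspace K 3)
    (offP : off_quadric P) : morphism (quadric K) (pspace K 2) :=
  morphism_of_polynomials (proj_poly offP).

Definition pulled_tangent (K : closedFieldType) (P : pspace K 3)
    (offP : off_quadric P) : vbundle (quadric K) 2 :=
  vpull (quadric_proj offP) (vtwist (ptangent K 2) (pline K 2 (-1))).

(* Main.v *)
Require Import Defs.
From mathcomp Require Import all_boot all_order all_algebra.
From mathcomp Require Import ring mpoly.
From mathcomp Require Import reals complex.
From Stdlib Require Import Classical ClassicalEpsilon.

(** A bundle E as in the theorem is studied through the pairing of its global
    sections.  An isomorphism det E = O(1,1) turns the wedge product of two
    global sections into a function of bidegree (1,1) on P^1 x P^1, which is a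
    bilinear form in the two sets of coordinates ([bireg_bilinear]; the content
    is that a function on the affine line that is locally a quotient of
    polynomials is a polynomial).  As E is globally generated of rank 2, a
    section is determined by its wedge products with the global sections, and
    these satisfy the Plucker relation [wedge_plucker].  No cohomology is then
    needed: conversely, a family of functions lam_u, indexed by the global
    sections u and compatible with the Plucker relation, is the family of wedge
    products of a section of a twist of E ([section_of_functional]).  This is
    how sections are divided by linear forms.

    First, if a nonzero global section s vanishes on a line x = a of one ruling
    and another one, t, on a line y = b of the other ruling, then E splits
    ([splits_of_two_rulings]).  Indeed the wedge of s and t vanishes on both
    lines, so it is c l_a(x) l_b(y) for the linear forms l_a, l_b that define
    them.  If c is not zero, s / l_a and t / l_b are everywhere independent and
    E = O(1,0) + O(0,1).  If c = 0, the Plucker relation shows that s is even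
    divisible by a form of bidegree (1,1), with a quotient whose wedge with some
    global section u is 1, and E = O(1,1) + O.

    Secondly, two independent global sections s, t that vanish at a point z
    have, for each of the two lines through z, a nonzero combination that
    vanishes on this line ([vanishing_on_ruling]): on the line, the wedge of s
    and t is a linear form that vanishes doubly at z, so it is zero.  Hence, if
    E does not split, the global sections that vanish at z form a space of
    dimension at most 1, and there are three global sections u, v, s that span
    all of them ([three_sections]).

    Finally, the three wedge products of u, v, s are bilinear forms without
    common zero.  Two bilinear forms always have a common zero
    ([bilinear_form_common_root]), so the three are independent, and as linear
    forms on P^3 they vanish together at a point P, which is off the
    quadric.  Up to a change of basis of the space of global sections they are
    the coordinates of the projection from P ([minors_projection]).  Both E and
    the pullback of TP^2(-1) are now the quotient of the trivial bundle of rank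
    3 by the line spanned by these coordinates: for E because u, v, s generate
    it and satisfy the relation given by their minors, for TP^2(-1) by the Euler
    sequence ([euler_mxP], [euler_trans]). *)

Set Implicit Arguments.
Unset Strict Implicit.
Unset Printing Implicit Defensive.

Import GRing.Theory.

Local Open Scope ring_scope.

(** * Local quotients of polynomials *)

Section Fractions.
Variable K : closedFieldType.
Implicit Types p q : {poly K}.

Lemma poly0_off_roots p q : q != 0 ->
  (forall t, q.[t] != 0 -> p.[t] = 0) -> p = 0.
Proof.
move=> q0 pq; suff /eqP : p * q = 0.
  by rewrite mulf_eq0 (negPf q0) orbF => /eqP.
apply/eqP; apply: contraT => /closed_nonrootP[t]; rewrite /root hornerM.
by case: (eqVneq q.[t] 0) => [->|/pq->]; rewrite ?mulr0 ?mul0r eqxx.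
Qed.

Definition locally_fraction (g : K -> K) : Prop :=
  forall t0, exists p q, q.[t0] != 0 /\ forall t, q.[t] != 0 -> g t = p.[t] / q.[t].

(** Write g near 0 as a reduced fraction p' / q'.  Every other local expression
    p1 / q1 of g agrees with it as a rational function, so q' divides q1.  Hence
    q' has no root, and it is constant since K is algebraically closed. *)
Lemma locally_fraction_poly g :
  locally_fraction g -> exists p, forall t, g t = p.[t].
Proof.
move=> gP; have [p [q [q0 gE]]] := gP 0.
have qn0 : q != 0 by apply: contraNneq q0 => ->; rewrite horner0.
have dn0 : gcdp p q != 0 by rewrite gcdp_eq0 negb_and qn0 orbT.
set p' := p %/ gcdp p q; set q' := q %/ gcdp p q.
have pE : p = p' * gcdp p q by rewrite divpK // dvdp_gcdl.
have qE : q = q' * gcdp p q by rewrite divpK // dvdp_gcdr.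
have cop : coprimep q' p' by rewrite coprimep_sym coprimep_div_gcd // qn0 orbT.
have key t1 : q'.[t1] != 0 /\ g t1 = p'.[t1] / q'.[t1].
  have [p1 [q1 [q1t g1E]]] := gP t1.
  have q1n0 : q1 != 0 by apply: contraNneq q1t => ->; rewrite horner0.
  have : p1 * q - p * q1 = 0.
    apply: (@poly0_off_roots _ (q * q1)); first by rewrite mulf_neq0.
    move=> t; rewrite hornerM mulf_eq0 negb_or => /andP[qt q1t'].
    have := gE t qt; rewrite g1E // => /eqP; rewrite eqr_div // => /eqP E.
    by rewrite hornerD hornerN !hornerM E; ring.
  have -> : p1 * q - p * q1 = (p1 * q' - p' * q1) * gcdp p q.
    by rewrite [in LHS]qE [in X in _ - X]pE; ring.
  move/eqP; rewrite mulf_eq0 (negPf dn0) orbF subr_eq0 => /eqP E.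
  have /dvdpP[r q1E] : q' %| q1.
    by rewrite -(Gauss_dvdpr _ cop) -E dvdp_mulIr.
  have q't : q'.[t1] != 0 by apply: contraNneq q1t => q't; rewrite q1E hornerM q't mulr0.
  split=> //; rewrite g1E //; apply/eqP; rewrite eqr_div // -!hornerM.
  by apply/eqP; rewrite E.
have q'1 : size q' = 1%N.
  apply/eqP; apply: contraT => /closed_rootP[t /eqP qt].
  by have [] := key t; rewrite qt eqxx.
have /size_poly1P[c c0 q'E] : size q' == 1%N by rewrite q'1.
exists (c^-1 *: p') => t; have [_ ->] := key t.
by rewrite q'E hornerC hornerZ mulrC.
Qed.

(** The equation, on the overlap t <> 0 of the two charts of P^1, says that
    X^N p is the sum of the q_k X^(N + m - k), with N the size of q; the degree
    of this sum is at most N + m. *)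
Lemma size_inversion p q m :
  (forall t, t != 0 -> p.[t] = t ^+ m * q.[t^-1]) -> (size p <= m.+1)%N.
Proof.
move=> pq; set N := size q.
pose r : {poly K} := \sum_(k < N) q`_k *: 'X^(N + m - k).
have rE : 'X^N * p = r.
  apply/eqP; rewrite -subr_eq0; apply/eqP.
  apply: (@poly0_off_roots _ 'X); first by rewrite polyX_eq0.
  move=> t; rewrite hornerX => t0; rewrite hornerD hornerN hornerM hornerXn pq //.
  rewrite horner_coef mulrA -exprD big_distrr horner_sum /= -sumrB big1 // => k _.
  rewrite hornerZ hornerXn expfB_cond; last first.
    by rewrite (negPf t0) add0n (leq_trans (ltnW (ltn_ord k))) ?leq_addr.
  by rewrite mulrCA exprVn subrr.
have : (size r <= N + m.+1)%N.
  apply: (leq_trans (size_sum _ _ _)); apply/bigmax_leqP => k _.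
  apply: (leq_trans (size_scale_leq _ _)); rewrite size_polyXn addnS ltnS.
  exact: leq_subr.
have [->|p0] := eqVneq p 0; first by rewrite size_poly0.
by rewrite -rE mulrC size_mulXn // leq_add2l.
Qed.

End Fractions.

(** * Regular functions *)

Section Regular.
Variable K : closedFieldType.
Implicit Types (X : hspace K).

Lemma regular_glue X (U : X -> Prop) (f : X -> K) :
  (forall z, U z -> exists O : X -> Prop,
     [/\ zopen O, O z & regular (fun y => U y /\ O y) f]) -> regular U f.
Proof.
move=> loc z Uz; have [O [oO Oz rf]] := loc z Uz.
have [d0 [q0 [h0 q0z q0O]]] := oO z Oz.
have [d [p [q [hp hq qz fE]]]] := rf z (conj Uz Oz).
exists (d + d0)%N, (p * q0), (q * q0); split; try exact: dhomogM.
  by rewrite /heval mevalM mulf_neq0.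
move=> y Uy; rewrite /heval !mevalM mulf_eq0 negb_or => /andP[qy q0y].
rewrite fE //; last by split=> //; apply: q0O.
by rewrite -mulf_div divff // mulr1.
Qed.

Lemma zopen_regular_neq0 X (U : X -> Prop) (f : X -> K) :
  zopen U -> regular U f -> zopen (fun z => U z /\ f z != 0).
Proof.
move=> oU rf z [Uz fz]; have [d0 [q0 [h0 q0z q0U]]] := oU z Uz.
have [d [p [q [hp hq qz fE]]]] := rf z Uz.
have pz : heval p z != 0.
  by move: fz; rewrite fE // mulf_eq0 negb_or => /andP[].
exists (d + d + d0)%N, (p * q * q0); split; try by do ?apply: dhomogM.
  by rewrite /heval !mevalM !mulf_neq0.
move=> y; rewrite /heval !mevalM !mulf_eq0 !negb_or => /andP[/andP[py qy] q0y].
by have Uy := q0U y q0y; split=> //; rewrite fE // mulf_neq0 // invr_neq0.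
Qed.

(** Functions of points do not have to be constant on proportional vectors, but
    regular ones are. *)
Lemma regular_scale X (U : X -> Prop) (f : X -> K) (z z' : X) (c : K) :
  regular U f -> U z -> U z' -> hcoord z' = c *: hcoord z -> f z' = f z.
Proof.
move=> rf Uz Uz' zE.
have c0 : c != 0.
  by apply: contraNneq (hcoord_neq0 z') => c0; rewrite zE c0 scale0r.
have [d [p [q [hp hq qz fE]]]] := rf z Uz.
have hE (r : {mpoly K[hdim X]}) : r \is d.-homog -> heval r z' = c ^+ d * heval r z.
  by move=> hr; apply: dhomog_scale => // k; rewrite zE mxE.
rewrite !fE // !hE ?mulf_neq0 ?expf_neq0 // -mulf_div divff ?expf_neq0 //.
by rewrite mul1r.
Qed.

Lemma horner_mmap n (p : {mpoly K[n]}) (v : 'I_n -> {poly K}) t :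
  (mmap polyC v p).[t] = p.@[fun k => (v k).[t]].
Proof.
rewrite /meval /mmap horner_sum; apply: eq_bigr => m _.
rewrite hornerM hornerC; congr (_ * _).
by rewrite /mmap1 horner_prod; apply: eq_bigr => i _; rewrite horner_exp.
Qed.

(** Pulling a local expression as a quotient of homogeneous polynomials back
    along a curve with polynomial coordinates gives a local expression as a
    quotient of polynomials in the parameter. *)
Lemma regular_curve X (U : X -> Prop) (f : X -> K) (phi : K -> X)
    (v : 'I_(hdim X) -> {poly K}) :
  (forall t k, hcoord (phi t) ord0 k = (v k).[t]) -> (forall t, U (phi t)) ->
  regular U f -> locally_fraction (fun t => f (phi t)).
Proof.
move=> phiE Uphi rf t0; have [d [p [q [hp hq qz fE]]]] := rf _ (Uphi t0).
have hE (r : {mpoly K[hdim X]}) t : (mmap polyC v r).[t] = heval r (phi t).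
  by rewrite horner_mmap /heval; apply: meval_eq => k; rewrite phiE.
exists (mmap polyC v p), (mmap polyC v q); rewrite hE; split=> // t.
by rewrite !hE => /fE ->.
Qed.

End Regular.

(** * Linear forms on the projective line *)

Section LinearForms.
Variable K : closedFieldType.
Notation P1 := (pspace K 1).
Notation co0 p := (hcoord (p : P1) ord0 (ord0 : 'I_2)).
Notation co1 p := (hcoord (p : P1) ord0 (ord_max : 'I_2)).

Lemma ord2P (k : 'I_2) : k = ord0 \/ k = ord_max.
Proof. by case: k => [[|[|]]] // i; [left|right]; apply: val_inj. Qed.

Lemma row2_neq0 (a b : K) : (a != 0) || (b != 0) ->
  \row_(k < 2) (if k == ord0 then a else b) != 0.
Proof.
apply: contraTneq => /rowP r0; have := r0 ord0; have := r0 ord_max.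
by rewrite !mxE /= => -> ->; rewrite eqxx.
Qed.

Definition point (a b : K) (ab : (a != 0) || (b != 0)) : P1 :=
  exist (fun v : 'rV[K]_2 => v != 0) _ (row2_neq0 ab).

Lemma pointE (a b : K) (ab : (a != 0) || (b != 0)) :
  co0 (point ab) = a /\ co1 (point ab) = b.
Proof. by rewrite !mxE. Qed.

Lemma coord_neq0 (p : P1) : (co0 p != 0) || (co1 p != 0).
Proof.
by have [k] := pspace_cover p; have [->|->] := ord2P k => ->; rewrite ?orbT.
Qed.

Definition linear_form (f : P1 -> K) : Prop :=
  exists c d, forall p, f p = c * co0 p + d * co1 p.

(** The linear form whose root is the point q. *)
Definition ell (q p : P1) : K := co0 q * co1 p - co1 q * co0 p.

Lemma ell_linear q : linear_form (ell q).
Proof. by exists (- co1 q), (co0 q) => p; rewrite /ell; ring. Qed.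

Lemma ellxx q : ell q q = 0.
Proof. by rewrite /ell; ring. Qed.

Lemma ell_neq0 q : exists p, ell q p != 0.
Proof.
have [q0|q0] := boolP (co0 q != 0).
  have h : (0 : K) != 0 \/ (1 : K) != 0 by right; apply: oner_neq0.
  exists (point (introT orP h)); have [E0 E1] := pointE (introT orP h).
  by rewrite /ell E0 E1 mulr0 subr0 mulr1.
have h : (1 : K) != 0 \/ (0 : K) != 0 by left; apply: oner_neq0.
exists (point (introT orP h)); have [E0 E1] := pointE (introT orP h).
have := coord_neq0 q; rewrite (negPf q0) /= => q1.
by rewrite /ell E0 E1 mulr0 add0r mulr1 oppr_eq0.
Qed.

Lemma linear_formD f g c d : linear_form f -> linear_form g ->
  linear_form (fun p => c * f p + d * g p).
Proof.
move=> [f0 [f1 fE]] [g0 [g1 gE]].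
by exists (c * f0 + d * g0), (c * f1 + d * g1) => p; rewrite fE gE; ring.
Qed.

Lemma linear_form_ext f g : (forall p, f p = g p) -> linear_form f -> linear_form g.
Proof. by move=> fg [c [d fE]]; exists c, d => p; rewrite -fg. Qed.

Lemma linear_form_root f q : linear_form f -> f q = 0 ->
  exists c, forall p, f p = c * ell q p.
Proof.
move=> [c [d fE]]; rewrite fE /ell => f0.
have [q0|q0] := boolP (co0 q != 0).
  exists (d / co0 q) => p; rewrite fE.
  have -> : c = - d * co1 q / co0 q.
    by apply: (mulIf q0); rewrite divfK // mulNr; apply/eqP; rewrite -addr_eq0 f0.
  by field.
move: f0; have := coord_neq0 q; rewrite (negPf q0) /= => q1.
have -> : co0 q = 0 by move/negPn/eqP: q0.
rewrite mulr0 add0r => /eqP; rewrite mulf_eq0 (negPf q1) orbF => /eqP d0.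
exists (- c / co1 q) => p; rewrite fE d0.
by field.
Qed.

(** A nonzero linear form has one root in P^1, and P^1 has more than two
    points: (1,0), (0,1) and (1,1) are enough to conclude. *)
Lemma linear_form_mul_eq0 f g : linear_form f -> linear_form g ->
  (forall p, f p * g p = 0) -> (exists p, g p != 0) -> forall p, f p = 0.
Proof.
move=> [c [d fE]] [c' [d' gE]] fg [p0 gp0].
have val a b : (a != 0) || (b != 0) -> (c * a + d * b) * (c' * a + d' * b) = 0.
  by move=> ab; have [E0 E1] := pointE ab; rewrite -[in c * a]E0 -[in d * b]E1
     -[in c' * a]E0 -[in d' * b]E1 -fE -gE.
have := val 1 0; have := val 0 1; have := val 1 1.
rewrite oner_neq0 /= eqxx /= !mulr1 !mulr0 !addr0 !add0r.
move=> /(_ isT) h11 /(_ isT) /eqP h01 /(_ isT) /eqP h10.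
move: h01 h10; rewrite !mulf_eq0.
have [d0|d0] := eqVneq d 0; have [c0|c0] := eqVneq c 0 => /=.
- by move=> _ _ p; rewrite fE c0 d0; ring.
- move=> _ /eqP c'0; move/eqP: h11; rewrite d0 c'0 addr0 add0r mulf_eq0 (negPf c0) /=.
  by move=> /eqP d'0; move: gp0; rewrite gE c'0 d'0 !mul0r addr0 eqxx.
- move=> /eqP d'0 _; move/eqP: h11; rewrite c0 d'0 addr0 add0r mulf_eq0 (negPf d0) /=.
  by move=> /eqP c'0; move: gp0; rewrite gE c'0 d'0 !mul0r addr0 eqxx.
by move=> /eqP d'0 /eqP c'0; move: gp0; rewrite gE c'0 d'0 !mul0r addr0 eqxx.
Qed.

(** The product vanishes doubly at q and its second factor does not vanish
    there, so a nonzero f would have a double root. *)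
Lemma linear_form_double_root f g q c : linear_form f -> linear_form g ->
  f q = 0 -> g q != 0 -> (forall p, f p * g p = c * ell q p ^+ 2) ->
  forall p, f p = 0.
Proof.
move=> lf lg fq gq fg; have [d fE] := linear_form_root lf fq.
have dg : forall p, d * g p + (- c) * ell q p = 0.
  apply: (@linear_form_mul_eq0 _ (ell q)); [|exact: ell_linear| |exact: ell_neq0].
    by apply: linear_formD; last exact: ell_linear.
  move=> r; have := fg r; rewrite fE => E.
  by rewrite mulrDl mulrAC E; ring.
have := dg q; rewrite ellxx mulr0 addr0 => /eqP; rewrite mulf_eq0 (negPf gq) orbF.
by move=> /eqP d0 p; rewrite fE d0 mul0r.
Qed.

(** Linearity is asked in each variable separately; the coefficients are only
    made explicit at the end, in [bilinear_form_coord]. *)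
Definition bilinear_form (F : quadric K -> K) : Prop :=
  (forall x, linear_form (fun y => F (x, y))) /\
  (forall y, linear_form (fun x => F (x, y))).

Definition affine0 (t : K) : P1 :=
  @point 1 t (introT orP (or_introl (oner_neq0 K))).
Definition affine1 (t : K) : P1 :=
  @point t 1 (introT orP (or_intror (oner_neq0 K))).

Lemma affine0E t : co0 (affine0 t) = 1 /\ co1 (affine0 t) = t.
Proof. exact: pointE. Qed.
Lemma affine1E t : co0 (affine1 t) = t /\ co1 (affine1 t) = 1.
Proof. exact: pointE. Qed.

Lemma scale_coord (p q : P1) c : hcoord p = c *: hcoord q <->
   co0 p = c * co0 q /\ co1 p = c * co1 q.
Proof.
split=> [->|[E0 E1]]; first by rewrite !mxE.
by apply/rowP => k; rewrite mxE; have [->|->] := ord2P k.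
Qed.

Section Homogeneous.
Variables (f : P1 -> K) (m : nat).
Hypothesis fZ : forall p q c, hcoord p = c *: hcoord q -> f p = c ^+ m * f q.
Hypotheses (frac0 : locally_fraction (fun t => f (affine0 t)))
           (frac1 : locally_fraction (fun t => f (affine1 t))).

Lemma homogeneous_affine p :
  if co0 p != 0 then f p = co0 p ^+ m * f (affine0 (co1 p / co0 p))
  else f p = co1 p ^+ m * f (affine1 0).
Proof.
case: ifP => p0; apply: fZ; apply/scale_coord.
  by have [-> ->] := affine0E (co1 p / co0 p); rewrite mulr1 mulrCA divff ?mulr1.
have [-> ->] := affine1E 0; rewrite mulr0 mulr1; split=> //.
by apply/eqP/negPn; rewrite p0.
Qed.

(** A homogeneous function of degree m on P^1 that is locally a quotient of
    polynomials in both affine charts is given by polynomials there, which are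
    related by inversion of the parameter. *)
Lemma homogeneous_poly : exists a b : {poly K},
  [/\ (size a <= m.+1)%N, forall t, f (affine0 t) = a.[t], forall t, f (affine1 t) = b.[t]
    & forall t, t != 0 -> a.[t] = t ^+ m * b.[t^-1]].
Proof.
have [a aE] := locally_fraction_poly frac0; have [b bE] := locally_fraction_poly frac1.
have ab t : t != 0 -> a.[t] = t ^+ m * b.[t^-1].
  move=> t0; rewrite -aE -bE; apply: fZ; apply/scale_coord.
  by have [-> ->] := affine0E t; have [-> ->] := affine1E t^-1; rewrite divff ?mulr1.
by exists a, b; split=> //; apply: size_inversion ab.
Qed.
End Homogeneous.

Lemma homogeneous_linear (f : P1 -> K) :
  (forall p q c, hcoord p = c *: hcoord q -> f p = c * f q) ->
  locally_fraction (fun t => f (affine0 t)) ->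
  locally_fraction (fun t => f (affine1 t)) -> linear_form f.
Proof.
move=> fZ l0 l1; have fZ1 p q c : hcoord p = c *: hcoord q -> f p = c ^+ 1 * f q.
  by rewrite expr1; apply: fZ.
have [a [b [sa aE bE ab]]] := homogeneous_poly fZ1 l0 l1.
have aE2 t : a.[t] = a`_0 + a`_1 * t.
  rewrite (horner_coef_wide _ sa) !big_ord_recl big_ord0 /= addr0.
  by rewrite expr0 mulr1 expr1.
have bE2 : b = a`_0 *: 'X + (a`_1)%:P.
  apply/eqP; rewrite -subr_eq0; apply/eqP.
  apply: (@poly0_off_roots _ _ 'X); first by rewrite polyX_eq0.
  move=> t; rewrite hornerX => t0; have := ab t^-1; rewrite invr_neq0 // => /(_ isT).
  rewrite aE2 invrK expr1 hornerD hornerN hornerD hornerZ hornerX hornerC => E.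
  have -> : b.[t] = t * (a`_0 + a`_1 * t^-1) by rewrite E mulrA divff ?mul1r.
  by field.
exists a`_0, a`_1 => p; have := homogeneous_affine fZ1 p.
case: ifP => p0 ->; first by rewrite aE aE2 expr1; field.
rewrite bE bE2 hornerD hornerZ hornerX hornerC expr1.
have -> : co0 p = 0 by apply/eqP/negPn; rewrite p0.
by ring.
Qed.

Lemma homogeneous_const (f : P1 -> K) :
  (forall p q c, hcoord p = c *: hcoord q -> f p = f q) ->
  locally_fraction (fun t => f (affine0 t)) ->
  locally_fraction (fun t => f (affine1 t)) -> forall p q, f p = f q.
Proof.
move=> fZ l0 l1; have fZ0 p q c : hcoord p = c *: hcoord q -> f p = c ^+ 0 * f q.
  by rewrite expr0 mul1r; apply: fZ.
have [a [b [sa aE bE ab]]] := homogeneous_poly fZ0 l0 l1.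
have aE2 t : a.[t] = a`_0.
  rewrite (horner_coef_wide _ sa) !big_ord_recl big_ord0 /= addr0.
  by rewrite expr0 mulr1.
have bE2 : b = (a`_0)%:P.
  apply/eqP; rewrite -subr_eq0; apply/eqP.
  apply: (@poly0_off_roots _ _ 'X); first by rewrite polyX_eq0.
  move=> t; rewrite hornerX => t0; have := ab t^-1; rewrite invr_neq0 // => /(_ isT).
  by rewrite aE2 invrK expr0 mul1r hornerD hornerN hornerC => ->; rewrite subrr.
suff fE p : f p = a`_0 by move=> p q; rewrite !fE.
have := homogeneous_affine fZ0 p.
by case: ifP => p0 ->; rewrite expr0 mul1r ?aE ?aE2 // bE bE2 hornerC.
Qed.

End LinearForms.

(** * Functions of a given bidegree on the quadric *)

Section QuadricFunctions.
Variable K : closedFieldType.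
Notation Q := (quadric K).
Notation P1 := (pspace K 1).
Notation xco z k := (hcoord ((z : Q).1 : P1) ord0 (k : 'I_2)).
Notation yco z k := (hcoord ((z : Q).2 : P1) ord0 (k : 'I_2)).

(** Regular sections of O(a,b) over U, seen as functions of bidegree (a,b) of
    the two vectors of homogeneous coordinates: division by a monomial of
    bidegree (a,b) in nonvanishing coordinates gives a regular function. *)
Definition bireg (U : Q -> Prop) (a b : int) (f : Q -> K) : Prop :=
  forall k l, regular (fun z => [/\ U z, xco z k != 0 & yco z l != 0])
                      (fun z => f z / (xco z k ^ a * yco z l ^ b)).

Implicit Types (U V : Q -> Prop) (f g : Q -> K) (a b c d : int).

Lemma monomial_neq0 (z : Q) k l a b : xco z k != 0 -> yco z l != 0 ->
  xco z k ^ a * yco z l ^ b != 0.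
Proof. by move=> xk yl; rewrite mulf_neq0 // expfz_neq0. Qed.

Lemma chart_open k l : zopen (fun z : Q => xco z k != 0 /\ yco z l != 0).
Proof.
move=> z [xk yl]; exists 1%N, 'X_(mxvec_index k l); split.
- by rewrite dhomogX /= mdeg1.
- by rewrite /heval mevalXU quadric_coord mulf_neq0.
- by move=> y; rewrite /heval mevalXU quadric_coord mulf_eq0 negb_or => /andP[].
Qed.

Lemma chart_cover (z : Q) : exists k l, xco z k != 0 /\ yco z l != 0.
Proof.
by have [k xk] := pspace_cover z.1; have [l yl] := pspace_cover z.2; exists k, l.
Qed.

Lemma bireg_ext U a b f g : (forall z, U z -> f z = g z) -> bireg U a b f -> bireg U a b g.
Proof.
move=> fg rf k l; apply: (regular_ext _ (rf k l)) => z [Uz _ _]; by rewrite fg.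
Qed.

Lemma bireg_sub U V a b f : (forall z, V z -> U z) -> bireg U a b f -> bireg V a b f.
Proof. by move=> VU rf k l; apply: (regular_sub _ (rf k l)) => z [/VU]. Qed.

Lemma bireg_glue U a b f :
  (forall z, U z -> exists O : Q -> Prop,
     [/\ zopen O, O z & bireg (fun y => U y /\ O y) a b f]) -> bireg U a b f.
Proof.
move=> loc k l; apply: regular_glue => z [Uz xk yl].
have [O [oO Oz rf]] := loc z Uz; exists O; split=> //.
by apply: regular_sub (rf k l) => y [[]].
Qed.

Lemma bireg0 U f : bireg U 0 0 f <-> regular U f.
Proof.
have E z k l : f z / (xco z k ^ 0 * yco z l ^ 0) = f z by rewrite !expr0z mulr1 divr1.
split=> [rf|rf k l].
  apply: regular_glue => z Uz; have [k [l [xk yl]]] := chart_cover z.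
  exists (fun z => xco z k != 0 /\ yco z l != 0); split=> //; first exact: chart_open.
  apply: (regular_ext (fun z _ => E z k l)).
  by apply: regular_sub (rf k l) => y [Uy []].
apply: (regular_ext (fun z _ => esym (E z k l))).
by apply: regular_sub rf => y [].
Qed.

Lemma bireg_const U (c : K) : bireg U 0 0 (fun=> c).
Proof. by apply/bireg0; apply: regular_const. Qed.

Lemma biregD U a b f g : bireg U a b f -> bireg U a b g -> bireg U a b (fun z => f z + g z).
Proof.
move=> rf rg k l; apply: (regular_ext _ (regularD (rf k l) (rg k l))) => z _.
by rewrite mulrDl.
Qed.

Lemma biregM U a b c d f g : bireg U a b f -> bireg U c d g ->
  bireg U (a + c) (b + d) (fun z => f z * g z).
Proof.
move=> rf rg k l; apply: (regular_ext _ (regularM (rf k l) (rg k l))).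
move=> z [Uz xk yl]; rewrite mulf_div !expfzDr //; congr (_ / _); ring.
Qed.

Lemma biregZ U a b f (c : K) : bireg U a b f -> bireg U a b (fun z => c * f z).
Proof.
by move=> rf; have := biregM (@bireg_const U c) rf; rewrite !add0r.
Qed.

Lemma biregB U a b f g : bireg U a b f -> bireg U a b g -> bireg U a b (fun z => f z - g z).
Proof.
move=> rf /(biregZ (-1)) rg; apply: bireg_ext (biregD rf rg) => z _.
by rewrite mulN1r.
Qed.

Lemma biregV U a b f : (forall z, U z -> f z != 0) -> bireg U a b f ->
  bireg U (- a) (- b) (fun z => (f z)^-1).
Proof.
move=> f0 rf k l.
have nz z : [/\ U z, xco z k != 0 & yco z l != 0] -> f z / (xco z k ^ a * yco z l ^ b) != 0.
  by move=> [/f0 fz xk yl]; rewrite mulf_neq0 // invr_neq0 // monomial_neq0.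
apply: (regular_ext _ (regularV nz (rf k l))) => z [Uz xk yl].
by rewrite invf_div mulrC invfM !invr_expz !opprK.
Qed.

Lemma bireg_x U k : bireg U 1 0 (fun z => xco z k).
Proof.
move=> k' l; pose i := mxvec_index k l; pose j := mxvec_index k' l.
apply: (@regular_ext _ _ _ (fun z : Q => hcoord z ord0 i / hcoord z ord0 j)).
  move=> z [_ xk yl]; rewrite !quadric_coord expr1z expr0z mulr1.
  by field; rewrite xk yl.
apply: regular_sub (@regular_ratio K Q i j) => z [_ xk yl].
by rewrite quadric_coord mulf_neq0.
Qed.

Lemma bireg_y U l : bireg U 0 1 (fun z => yco z l).
Proof.
move=> k l'; pose i := mxvec_index k l; pose j := mxvec_index k l'.
apply: (@regular_ext _ _ _ (fun z : Q => hcoord z ord0 i / hcoord z ord0 j)).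
  move=> z [_ xk yl]; rewrite !quadric_coord expr1z expr0z mul1r.
  by field; rewrite xk yl.
apply: regular_sub (@regular_ratio K Q i j) => z [_ xk yl].
by rewrite quadric_coord mulf_neq0.
Qed.

Lemma bireg_xlinear U (f : P1 -> K) : linear_form f -> bireg U 1 0 (fun z => f z.1).
Proof.
move=> [c [d fE]]; apply: (bireg_ext (fun z _ => esym (fE z.1))).
by apply: biregD; apply: biregZ; apply: bireg_x.
Qed.

Lemma bireg_ylinear U (f : P1 -> K) : linear_form f -> bireg U 0 1 (fun z => f z.2).
Proof.
move=> [c [d fE]]; apply: (bireg_ext (fun z _ => esym (fE z.2))).
by apply: biregD; apply: biregZ; apply: bireg_y.
Qed.

Lemma zopen_bireg_neq0 a b f : bireg (fun=> True) a b f -> zopen (fun z => f z != 0).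
Proof.
move=> rf z fz; have [k [l [xk yl]]] := chart_cover z.
have oC : zopen (fun z : Q => [/\ True, xco z k != 0 & yco z l != 0]).
  by move=> y [_ xy yy]; have [e [q [hq qy qC]]] := chart_open (conj xy yy);
     exists e, q; split=> // w /qC[].
have [|e [q [hq qz qU]]] := @zopen_regular_neq0 _ _ _ _ oC (rf k l) z.
  by split=> //; rewrite mulf_neq0 // invr_neq0 // monomial_neq0.
exists e, q; split=> // y /qU[_]; by rewrite mulf_eq0 negb_or => /andP[].
Qed.

(** Exchanging the factors reduces statements on the second variable to
    statements on the first one. *)
Definition swap (z : Q) : Q := (z.2, z.1).

Lemma swap_poly : locally_polynomial swap.
Proof.
pose v : 'M[{mpoly K[2 * 2]}]_2 := \matrix_(i, j) 'X_(mxvec_index j i).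
move=> z; exists 1%N, [tuple mxvec v ord0 k | k < 2 * 2], (fun=> 1); split=> [k||y k].
- rewrite tnth_mktuple; case/mxvec_indexP: k => i j.
  by rewrite mxvecE mxE dhomogX /= mdeg1.
- exact: oner_neq0.
rewrite tnth_mktuple; case/mxvec_indexP: k => i j.
by rewrite mxvecE mxE /heval mevalXU !quadric_coord mul1r mulrC.
Qed.

Lemma bireg_swap a b f : bireg (fun=> True) a b f ->
  bireg (fun=> True) b a (fun z => f (swap z)).
Proof.
move=> rf k l; have := locally_polynomial_regular swap_poly (rf l k).
move=> rf'; apply: (@regular_ext _ _ _
  (fun z => f (swap z) / (xco (swap z) l ^ a * yco (swap z) k ^ b))).
  by move=> z _ /=; rewrite [X in _ / X]mulrC.
by apply: regular_sub rf' => z [].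
Qed.

Lemma bireg_xscale a b f (x x' y : P1) (c : K) : bireg (fun=> True) a b f ->
  hcoord x = c *: hcoord x' -> f (x, y) = c ^ a * f (x', y).
Proof.
move=> rf xE; have [k xk] := pspace_cover x'; have [l yl] := pspace_cover y.
have c0 : c != 0.
  by apply: contraNneq (hcoord_neq0 x) => c0; rewrite xE c0 scale0r.
have xkE : hcoord x ord0 k = c * hcoord x' ord0 k by rewrite xE mxE.
have zE : hcoord ((x, y) : Q) = c *: hcoord ((x', y) : Q).
  apply/rowP => m; case/mxvec_indexP: m => i j.
  by rewrite [RHS]mxE !quadric_coord /= -[val x]/(hcoord x) xE mxE mulrA.
have := regular_scale (rf k l) _ _ zE => /(_ _ _)/= E.
have xk' : hcoord x ord0 k != 0 by rewrite xkE mulf_neq0.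
have := E (And3 I xk yl) (And3 I xk' yl); rewrite xkE expfzMl -mulrA => E'.
have n0 := @monomial_neq0 (x', y) k l a b xk yl; rewrite /= in n0.
have ca : c ^ a != 0 by rewrite expfz_neq0.
move/eqP: E'; rewrite (eqr_div _ _ (mulf_neq0 ca n0) n0) => /eqP E'.
apply: (mulIf n0); rewrite E'; ring.
Qed.

(** In an affine chart of the first factor the coordinate k0 is 1 and y is
    fixed, so the monomial that makes f regular is a nonzero constant. *)
Lemma bireg_affine a b f (A : K -> P1) (k0 : 'I_2) (y : P1) :
  (forall t, hcoord (A t) ord0 k0 = 1) ->
  (exists v : 'I_2 -> {poly K}, forall t k, hcoord (A t) ord0 k = (v k).[t]) ->
  bireg (fun=> True) a b f -> locally_fraction (fun t => f (A t, y)).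
Proof.
move=> A1 [v vE] rf; have [l yl] := pspace_cover y.
pose w : 'M[{poly K}]_2 := \matrix_(i, j) (v i * (hcoord y ord0 j)%:P).
have wE t k : hcoord ((A t, y) : Q) ord0 k = (mxvec w ord0 k).[t].
  case/mxvec_indexP: k => i j.
  by rewrite quadric_coord mxvecE mxE /= hornerM hornerC vE.
have inU t : [/\ True, xco (A t, y) k0 != 0 & yco (A t, y) l != 0].
  by rewrite /= A1 oner_neq0.
have frac := regular_curve wE inU (rf k0 l).
move=> t0; have [p [q [q0 E]]] := frac t0; pose c := hcoord y ord0 l ^ b.
have c0 : c != 0 by rewrite expfz_neq0.
exists (c *: p), q; split=> // t /E /=; rewrite A1 exp1rz mul1r hornerZ => Et.
by rewrite -mulrA -Et mulrC divfK.
Qed.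

Lemma affine0_poly : exists v : 'I_2 -> {poly K},
  forall t k, hcoord (affine0 t) ord0 k = (v k).[t].
Proof.
exists (fun k => if k == ord0 then 1 else 'X) => t k.
by rewrite mxE; case: ifP; rewrite ?hornerX ?hornerE.
Qed.

Lemma affine1_poly : exists v : 'I_2 -> {poly K},
  forall t k, hcoord (affine1 t) ord0 k = (v k).[t].
Proof.
exists (fun k => if k == ord0 then 'X else 1) => t k.
by rewrite mxE; case: ifP; rewrite ?hornerX ?hornerE.
Qed.

Lemma bireg_fractions a b f y : bireg (fun=> True) a b f ->
  locally_fraction (fun t => f (affine0 t, y)) /\
  locally_fraction (fun t => f (affine1 t, y)).
Proof.
move=> rf; split.
  have A1 (t : K) : hcoord (affine0 t) ord0 (ord0 : 'I_2) = 1 by have [] := affine0E t.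
  exact: (bireg_affine y A1 affine0_poly rf).
have A1 (t : K) : hcoord (affine1 t) ord0 (ord_max : 'I_2) = 1 by have [] := affine1E t.
exact: (bireg_affine y A1 affine1_poly rf).
Qed.

Lemma bireg_linear_x b f y : bireg (fun=> True) 1 b f -> linear_form (fun x => f (x, y)).
Proof.
move=> rf; have [r0 r1] := bireg_fractions y rf.
apply: homogeneous_linear => // p q c /(bireg_xscale y rf).
by rewrite expr1z.
Qed.

Lemma bireg_const_x b f y : bireg (fun=> True) 0 b f -> forall x x', f (x, y) = f (x', y).
Proof.
move=> rf; have [r0 r1] := bireg_fractions y rf.
apply: (@homogeneous_const _ (fun x => f (x, y))) => // p q c /(bireg_xscale y rf).
by rewrite expr0z mul1r.
Qed.

(** H^0(O(1,1)) is the space of bilinear forms: this and the next lemma are the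
    only computations of global sections of line bundles. *)
Lemma bireg_bilinear f : bireg (fun=> True) 1 1 f -> bilinear_form f.
Proof.
move=> rf; split=> [x|y]; last exact: bireg_linear_x rf.
exact: (bireg_linear_x x (bireg_swap rf)).
Qed.

Lemma bireg_global_const f : bireg (fun=> True) 0 0 f -> forall z z', f z = f z'.
Proof.
move=> rf [x y] [x' y']; rewrite (bireg_const_x y rf x x').
exact: (bireg_const_x x' (bireg_swap rf) y y').
Qed.

End QuadricFunctions.

(** * Wedge products of sections *)

Section Wedge.
Variable K : closedFieldType.
Notation Q := (quadric K).

Definition det2 (v w : 'cV[K]_2) : K :=
  v ord0 ord0 * w ord_max ord0 - v ord_max ord0 * w ord0 ord0.

Lemma det2_row_mx (v w : 'cV[K]_2) : \det (row_mx v w : 'M_2) = det2 v w.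
Proof.
have E0 : (ord0 : 'I_2) = lshift 1 (ord0 : 'I_1) by apply: val_inj.
have E1 : (ord_max : 'I_2) = rshift 1 (ord0 : 'I_1) by apply: val_inj.
have D2 (A : 'M[K]_2) :
    \det A = A ord0 ord0 * A ord_max ord_max - A ord_max ord0 * A ord0 ord_max.
  have L0 : lift ord0 (ord0 : 'I_1) = ord_max :> 'I_2 by apply: val_inj.
  have L1 : lift ord_max (ord0 : 'I_1) = ord0 :> 'I_2 by apply: val_inj.
  rewrite (expand_det_col _ (ord0 : 'I_2)) !big_ord_recl big_ord0 addr0 /cofactor.
  by rewrite !L0 !det_mx11 !mxE /= !L0 !L1 /= expr0 mul1r expr1 mulN1r mulrN.
have El k : (row_mx v w : 'M_2) k ord0 = v k ord0 by rewrite E0; apply: (row_mxEl v w).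
have Er k : (row_mx v w : 'M_2) k ord_max = w k ord0 by rewrite E1; apply: (row_mxEr v w).
by rewrite D2 !El !Er.
Qed.

Lemma det2_mulmx (g : 'M[K]_2) (v w : 'cV[K]_2) :
  det2 (g *m v) (g *m w) = \det g * det2 v w.
Proof. by rewrite -!det2_row_mx -mul_mx_row det_mulmx. Qed.

Variable E : vbundle Q 2.
Notation section := (vidx E -> Q -> 'cV[K]_2).
Implicit Types (s t u v r : section) (a b c d : int).

(** Sections of the twist of E by O(a,b), in the trivialisations of E alone:
    their coordinates are functions of bidegree (a,b). *)
Definition twisted_section a b s : Prop :=
  (forall i k, bireg (vdom E i) a b (fun z => s i z k ord0)) /\
  (forall i j z, vdom E i z -> vdom E j z -> s i z = vtrans E i j z *m s j z).

Lemma twisted_section0 s : global_section s <-> twisted_section 0 0 s.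
Proof.
split=> [] [rs ts]; split=> // i k.
  by apply/bireg0/rs.
by move=> l; rewrite ord1; apply/bireg0/rs.
Qed.

Lemma twisted_of_global s : global_section s -> twisted_section 0 0 s.
Proof. exact: proj1 (twisted_section0 s). Qed.

(** Sections are families of functions indexed by an arbitrary type, so their
    linear combinations are written out. *)
Definition comb (x : K) s (y : K) t : section := fun i z => x *: s i z + y *: t i z.

Lemma twisted_section_comb a b x y s t : twisted_section a b s ->
  twisted_section a b t -> twisted_section a b (comb x s y t).
Proof.
move=> [rs ts] [rt tt]; split=> [i k|i j z iz jz].
  apply: (bireg_ext (f := fun z => x * s i z k ord0 + y * t i z k ord0)).
    by move=> z _; rewrite !mxE.
  by apply: biregD; apply: biregZ.
by rewrite /comb (ts i j) // (tt i j) // mulmxDr -!scalemxAr.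
Qed.

Lemma global_section_comb x y s t :
  global_section s -> global_section t -> global_section (comb x s y t).
Proof.
by move=> /twisted_section0 gs /twisted_section0 gt; apply/twisted_section0/twisted_section_comb.
Qed.

(** An isomorphism det E = O(1,1), in the trivialisations of E alone: delta_i
    is the image of the i-th frame, a nonvanishing function of bidegree (1,1). *)
Definition det_frame (delta : vidx E -> Q -> K) : Prop :=
  [/\ forall i, bireg (vdom E i) 1 1 (delta i),
      forall i z, vdom E i z -> delta i z != 0
    & forall i j z, vdom E i z -> vdom E j z ->
        delta j z = delta i z * \det (vtrans E i j z)].

Lemma det_frame_c1 : has_c1 E 1%Z 1%Z -> exists delta, det_frame delta.
Proof.
move=> [h [k [[rh th] _ hk]]].
pose L := quadric_line K 1%Z 1%Z.
have trL (p q : vidx L) (z : Q) : vtrans L p q z ord0 ord0 =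
  hcoord z.2 ord0 (q.2 : 'I_2) / hcoord z.2 ord0 (p.2 : 'I_2) *
  (hcoord z.1 ord0 (q.1 : 'I_2) / hcoord z.1 ord0 (p.1 : 'I_2)).
  by rewrite /= !mxE /= !mulr1n !expr1z.
pose kx (z : Q) : 'I_2 := xchoose (pspace_cover z.1).
pose ky (z : Q) : 'I_2 := xchoose (pspace_cover z.2).
pose lz (z : Q) : vidx L := (kx z, ky z).
have lzP z : vdom L (lz z) z.
  by split; [apply: xchooseP (pspace_cover z.1)|apply: xchooseP (pspace_cover z.2)].
(* The coordinate in the chart p of O(1,1), made homogeneous: this removes the
   dependence on p. *)
pose F (p : vidx L) i (z : Q) :=
  h p i z ord0 ord0 * (hcoord z.1 ord0 (p.1 : 'I_2) * hcoord z.2 ord0 (p.2 : 'I_2)).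
have Findep p q i j z : vdom L p z -> vdom L q z -> vdom E i z -> vdom E j z ->
    F q j z = F p i z * \det (vtrans E i j z).
  move=> pz qz iz jz; have := th p q i j z pz qz iz jz.
  move/matrixP/(_ ord0 ord0); rewrite !mxE !big_ord1 trL mxE eqxx mulr1n /F => E1.
  move: pz => [/= px py]; rewrite mulrAC -E1; field; by rewrite px py.
exists (fun i z => F (lz z) i z); split.
- move=> i p q; pose m : vidx L := (p, q).
  apply: (@regular_ext _ _ _ (fun z => h m i z ord0 ord0)); last first.
    by apply: regular_sub (rh m i ord0 ord0) => z [? ? ?]; split.
  move=> z [iz xp yq].
  rewrite (@Findep m _ i i) // (vtrans_id iz) det1 mulr1 /F /= !expr1z.
  by rewrite mulfK // mulf_neq0.
- move=> i z iz; have [/= xk yk] := lzP z; rewrite mulf_neq0 ?mulf_neq0 //.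
  have [/matrixP/(_ ord0 ord0)] := hk (lz z) i z (lzP z) iz.
  rewrite !mxE big_ord1 eqxx => E1 _; apply/eqP => h0.
  by move: E1; rewrite h0 mul0r => /eqP; rewrite eq_sym oner_eq0.
by move=> i j z iz jz; apply: Findep.
Qed.

Variable delta : vidx E -> Q -> K.
Hypothesis deltaP : det_frame delta.

Definition chart_at (z : Q) : vidx E :=
  proj1_sig (constructive_indefinite_description _ (vdom_cover E z)).

Lemma chart_atP z : vdom E (chart_at z) z.
Proof. exact: proj2_sig (constructive_indefinite_description _ (vdom_cover E z)). Qed.

(** The image of the wedge product of s and t under the isomorphism
    det E = O(1,1) given by delta; by [wedgeE] any chart around z may replace
    the chosen one. *)
Definition wedge s t (z : Q) : K :=
  delta (chart_at z) z * det2 (s (chart_at z) z) (t (chart_at z) z).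

Lemma wedgeE a b c d s t i z :
  twisted_section a b s -> twisted_section c d t -> vdom E i z ->
  wedge s t z = delta i z * det2 (s i z) (t i z).
Proof.
case: deltaP => _ _ dE [_ ts] [_ tt] iz; have jz := chart_atP z.
by rewrite /wedge (ts i _ _ iz jz) (tt i _ _ iz jz) det2_mulmx (dE i _ _ iz jz) mulrA.
Qed.

Lemma bireg_wedge a b c d s t : twisted_section a b s -> twisted_section c d t ->
  bireg (fun=> True) (1 + (a + c)) (1 + (b + d)) (wedge s t).
Proof.
move=> hs ht; apply: bireg_glue => z _; exists (vdom E (chart_at z)); split.
- exact: vdom_open.
- exact: chart_atP.
apply: (bireg_ext (f := fun y => delta (chart_at z) y *
   det2 (s (chart_at z) y) (t (chart_at z) y))) => [y [_ iy]|].
  by rewrite (wedgeE hs ht iy).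
apply: (bireg_sub (U := vdom E (chart_at z))) => [y []//|].
case: deltaP => rd _ _; apply: biregM => //.
case: hs ht => [rs _] [rt _].
by apply: biregB; apply: biregM.
Qed.

Lemma wedge_comb x y s t u z :
  wedge (comb x s y t) u z = x * wedge s u z + y * wedge t u z.
Proof. by rewrite /wedge /det2 !mxE; ring. Qed.

Lemma wedgeC s t z : wedge s t z = - wedge t s z.
Proof. by rewrite /wedge /det2; ring. Qed.

Lemma wedgess s z : wedge s s z = 0.
Proof. by rewrite /wedge /det2; ring. Qed.

(** A relation between minors of a 2 x 4 matrix, which holds for arbitrary
    families s, t, u, v since it only involves their values at z. *)
Lemma wedge_plucker s t u v z :
  wedge s t z * wedge u v z = wedge s u z * wedge t v z - wedge s v z * wedge t u z.
Proof. by rewrite /wedge /det2; ring. Qed.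

Hypothesis Egg : globally_generated E.

Lemma wedge_bilinear s t :
  global_section s -> global_section t -> bilinear_form (wedge s t).
Proof.
move=> /twisted_section0 hs /twisted_section0 ht; apply: bireg_bilinear.
by have := bireg_wedge hs ht; rewrite !addr0.
Qed.

Lemma wedge_neq0_ex z : exists u v,
  [/\ global_section u, global_section v & wedge u v z != 0].
Proof.
have iz := chart_atP z.
have [u gu uE] := Egg iz (delta_mx ord0 ord0).
have [v gv vE] := Egg iz (delta_mx ord_max ord0).
exists u, v; split=> //; rewrite /wedge uE vE /det2 !mxE /= !mulr1 mul0r subr0 mulr1.
by case: deltaP => _ /(_ _ _ iz).
Qed.

(** The wedge product identifies the fibre of E with its dual, up to the twist,
    and the fibre is spanned by global sections.  The Plucker relation says that
    u |-> lam_u is induced by a linear form on the fibre at every point; this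
    provides a section without any division of local functions. *)
Lemma section_of_functional a b (lam : section -> Q -> K) :
  (forall u, global_section u -> bireg (fun=> True) (1 + a) (1 + b) (lam u)) ->
  (forall u v r z, global_section u -> global_section v -> global_section r ->
     lam r z * wedge u v z = lam v z * wedge u r z - lam u z * wedge v r z) ->
  exists s, twisted_section a b s /\ forall u z, global_section u -> wedge s u z = lam u z.
Proof.
move=> rlam plam.
pose T z := {uv : section * section |
  [/\ global_section uv.1, global_section uv.2 & wedge uv.1 uv.2 z != 0]}.
have tz z : T z.
  apply: constructive_indefinite_description; have [u [v H]] := wedge_neq0_ex z.
  by exists (u, v).
(* Cramer: near z the section is a combination of a frame u, v, and its wedge
   products with u and v give the coefficients. *)
pose S u v i z : 'cV[K]_2 := (wedge u v z)^-1 *: (lam v z *: u i z - lam u z *: v i z).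
have SE i z u v w :
    (forall r, global_section r -> delta i z * det2 w (r i z) = lam r z) ->
    vdom E i z -> global_section u -> global_section v -> wedge u v z != 0 ->
    w = S u v i z.
  move=> wP iz gu gv uv0; have := wP _ gu; have := wP _ gv.
  have [_ /(_ _ _ iz) d0 _] := deltaP.
  rewrite /S; rewrite (wedgeE (twisted_of_global gu) (twisted_of_global gv) iz) in uv0 *.
  move=> <- <-; apply/matrixP => k l; rewrite ord1 !mxE; move: uv0.
  rewrite mulf_eq0 negb_or /det2 => /andP[_ n0].
  by have [->|->] := ord2P k; field; rewrite n0 d0.
have SP i z u v r : vdom E i z -> global_section u -> global_section v ->
    wedge u v z != 0 -> global_section r -> delta i z * det2 (S u v i z) (r i z) = lam r z.
  move=> iz gu gv uv0 gr; apply: (mulIf uv0); rewrite plam //.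
  have [[gu' gv'] gr'] := (twisted_of_global gu, twisted_of_global gv, twisted_of_global gr).
  rewrite (wedgeE gu' gr' iz) (wedgeE gv' gr' iz) /S.
  by rewrite /det2 !mxE; field.
pose s : section := fun i z => S (sval (tz z)).1 (sval (tz z)).2 i z.
(* The value does not depend on the frame, so a frame can be fixed locally. *)
have sP i z u v : vdom E i z -> global_section u -> global_section v ->
    wedge u v z != 0 -> s i z = S u v i z.
  move=> iz gu gv uv0; apply: SE => // r gr.
  have [h1 h2 h3] := svalP (tz z); exact: SP.
have sT : twisted_section a b s.
  split=> [i k|i j z iz jz]; last first.
    have [h1 h2 h3] := svalP (tz z); rewrite /s /S.
    have [[_ tu] [_ tv]] := (twisted_of_global h1, twisted_of_global h2).
    by rewrite (tu i j) // (tv i j) // -scalemxAr mulmxBr -!scalemxAr.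
  apply: bireg_glue => z iz; have [h1 h2 h3] := svalP (tz z).
  set u := (sval (tz z)).1 in h1 h3; set v := (sval (tz z)).2 in h2 h3.
  exists (fun y => wedge u v y != 0); split=> //.
    have [hu hv] := (twisted_of_global h1, twisted_of_global h2).
    exact: zopen_bireg_neq0 (bireg_wedge hu hv).
  apply: (bireg_ext (f := fun y => (wedge u v y)^-1 *
      (lam v y * u i y k ord0 - lam u y * v i y k ord0))).
    by move=> y [iy uvy]; rewrite (sP i y u v) // !mxE.
  have [hu hv] := (twisted_of_global h1, twisted_of_global h2).
  have rW : bireg (fun y => vdom E i y /\ wedge u v y != 0) (- 1) (- 1)
      (fun y => (wedge u v y)^-1).
    apply: biregV => [y []//|]; have := bireg_wedge hu hv; rewrite !addr0.
    exact: bireg_sub.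
  have r1 (w x : section) : global_section w -> twisted_section 0 0 x ->
      bireg (fun y => vdom E i y /\ wedge u v y != 0) (1 + a) (1 + b)
      (fun y => lam w y * x i y k ord0).
    move=> gw [rx _]; rewrite -[1 + a]addr0 -[1 + b]addr0; apply: biregM.
      by apply: bireg_sub (rlam w gw).
    by apply: bireg_sub (rx i k) => y [].
  have := biregM rW (biregB (r1 _ _ h2 hu) (r1 _ _ h1 hv)).
  by rewrite !addKr.
exists s; split=> // r z gr; have iz := chart_atP z.
rewrite (wedgeE sT (twisted_of_global gr) iz).
by have [h1 h2 h3] := svalP (tz z); apply: SP.
Qed.

End Wedge.

(** * Isomorphisms and direct sums of line bundles *)

Section Isomorphisms.
Variable K : closedFieldType.

(** The entries of the inverse are cofactors divided by the determinant. *)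
Lemma regular_invmx (X : hspace K) (U : X -> Prop) n (A : X -> 'M[K]_n) :
  (forall x, U x -> A x \in unitmx) -> regular_mx U A ->
  regular_mx U (fun x => invmx (A x)).
Proof.
move=> uA rA k l.
apply: (regular_ext (f := fun x => (\det (A x))^-1 *
   ((-1) ^+ (l + k) * \det (row' l (col' k (A x)))))).
  by move=> x Ux; rewrite /invmx uA // !mxE.
apply: regularM.
  apply: regularV; last exact: regular_det.
  by move=> x Ux; have := uA x Ux; rewrite unitmxE unitfE.
apply: regularM; first exact: regular_const.
apply: regular_det => i j; apply: (regular_ext (f := fun x => A x (lift l i) (lift k j))) => //.
by move=> x _; rewrite !mxE.
Qed.

(** The inverse matrices of an invertible homomorphism are again a regular and
    compatible family. *)
Lemma visom_of_unit (X : hspace K) r (E F : vbundle X r)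
    (k : vidx E -> vidx F -> X -> 'M[K]_r) :
  vhom (E := F) (F := E) k ->
  (forall i a x, vdom E i x -> vdom F a x -> k i a x \in unitmx) -> visom E F.
Proof.
move=> [rk tk] uk; exists (fun a i x => invmx (k i a x)), k; split=> //; last first.
  by move=> a i x ax ix; rewrite mulVmx ?mulmxV ?uk.
split=> [a i|a b i j x ax bx ix jx].
  apply: regular_invmx => [x [ax ix]|]; first exact: uk.
  by move=> p q; apply: regular_sub (rk i a p q) => x [].
apply: (can_inj (mulKmx (uk i a x ix ax))).
apply: (can_inj (mulmxK (uk j b x jx bx))).
rewrite !mulmxA mulmxV ?uk // mul1mx -(tk i j) //.
by rewrite -mulmxA mulVmx ?uk // mulmx1.
Qed.

Variable E : vbundle (quadric K) 2.
Variable delta : vidx E -> quadric K -> K.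
Hypothesis deltaP : det_frame delta.
Notation section := (vidx E -> quadric K -> 'cV[K]_2).
Notation wedge := (wedge delta).

Lemma quadric_lineE (a b : int) (p q : vidx (quadric_line K a b)) z :
  vtrans (quadric_line K a b) p q z ord0 ord0 =
  (hcoord z.2 ord0 (q.2 : 'I_2) / hcoord z.2 ord0 (p.2 : 'I_2)) ^ b *
  (hcoord z.1 ord0 (q.1 : 'I_2) / hcoord z.1 ord0 (p.1 : 'I_2)) ^ a.
Proof. by rewrite /= !mxE /= !mulr1n. Qed.

(** The monomial by which a coordinate in a chart of O(a,b) is multiplied to
    become a function of bidegree (a,b). *)
Definition line_factor (a b : int) (p : vidx (quadric_line K a b)) (z : quadric K) : K :=
  hcoord z.1 ord0 (p.1 : 'I_2) ^ a * hcoord z.2 ord0 (p.2 : 'I_2) ^ b.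

Lemma line_factor_trans a b (p q : vidx (quadric_line K a b)) z :
  vdom (quadric_line K a b) p z ->
  line_factor p z * vtrans (quadric_line K a b) p q z ord0 ord0 = line_factor q z.
Proof.
have cancel (u v : K) n : v != 0 -> v ^ n * (u / v) ^ n = u ^ n.
  by move=> v0; rewrite -expfzMl mulrCA divff ?mulr1.
move=> [/= px py]; rewrite quadric_lineE /line_factor.
by rewrite [X in _ * X]mulrC mulrACA !cancel.
Qed.

Lemma line_factor_neq0 a b (p : vidx (quadric_line K a b)) z :
  vdom (quadric_line K a b) p z -> line_factor p z != 0.
Proof. by move=> [/= px py]; rewrite mulf_neq0 // expfz_neq0. Qed.

Lemma twisted_line_regular a b (s : section) i
    (p : vidx (quadric_line K (- a) (- b))) k : twisted_section a b s ->
  regular (fun z => vdom E i z /\ vdom (quadric_line K (- a) (- b)) p z)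
          (fun z => line_factor p z * s i z k ord0).
Proof.
move=> [rs _]; apply: (regular_ext (f := fun z => s i z k ord0 /
   (hcoord z.1 ord0 (p.1 : 'I_2) ^ a * hcoord z.2 ord0 (p.2 : 'I_2) ^ b))).
  by move=> z _; rewrite /line_factor mulrC invfM !invr_expz.
by apply: regular_sub (rs i k p.1 p.2) => z [iz [px py]].
Qed.

(** A section of the twist of E by O(a,b) is a homomorphism from O(-a,-b) to E;
    the wedge product of the two sections is the determinant of the homomorphism
    from the direct sum. *)
Lemma splits_of_sections a b c d (s t : section) :
  twisted_section a b s -> twisted_section c d t ->
  (forall z, wedge s t z != 0) -> splits E.
Proof.
move=> hs ht st0; pose L := quadric_line K (- a) (- b); pose M := quadric_line K (- c) (- d).
exists L, M.
pose k (i : vidx E) (p : vidx (vsum L M)) (z : quadric K) : 'M[K]_(2, 1 + 1) :=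
  row_mx (line_factor (p.1 : vidx L) z *: s i z) (line_factor (p.2 : vidx M) z *: t i z).
apply: (@visom_of_unit _ _ E (vsum L M) k); last first.
  move=> i p z iz [pz1 pz2]; rewrite unitmxE unitfE (det2_row_mx (K := K)).
  have := st0 z; rewrite (wedgeE deltaP hs ht iz) mulf_eq0 negb_or => /andP[_ n0].
  have -> : det2 (line_factor (p.1 : vidx L) z *: s i z)
                 (line_factor (p.2 : vidx M) z *: t i z) =
      line_factor (p.1 : vidx L) z * line_factor (p.2 : vidx M) z * det2 (s i z) (t i z).
    by rewrite /det2 !mxE; ring.
  by rewrite mulf_neq0 // mulf_neq0 // line_factor_neq0.
split=> [i p k' l|i j p q z iz jz [/= pz1 pz2] [/= qz1 qz2]].
  rewrite -(@splitK 1 1 l); case: (@split 1 1 l) => l' /=; rewrite (ord1 l').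
    apply: (regular_ext (f := fun z => line_factor (p.1 : vidx L) z * s i z k' ord0)).
      move=> z _; apply: etrans (esym (row_mxEl (line_factor (p.1 : vidx L) z *: s i z)
      (line_factor (p.2 : vidx M) z *: t i z) k' ord0)); by rewrite mxE.
    have := @twisted_line_regular a b s i (p.1 : vidx L) k' hs.
    by apply: regular_sub => z [? []].
  apply: (regular_ext (f := fun z => line_factor (p.2 : vidx M) z * t i z k' ord0)).
    move=> z _; apply: etrans (esym (row_mxEr (line_factor (p.1 : vidx L) z *: s i z)
      (line_factor (p.2 : vidx M) z *: t i z) k' ord0)); by rewrite mxE.
  have := @twisted_line_regular c d t i (p.2 : vidx M) k' ht.
  by apply: regular_sub => z [? []].
case: hs ht => _ ts [_ tt].
have glue (A : 'M[K]_2) (v w v' w' : 'cV[K]_2) (x y : 'M[K]_1) :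
    A *m v = x ord0 ord0 *: v' -> A *m w = y ord0 ord0 *: w' ->
    A *m row_mx v w = row_mx v' w' *m block_mx x 0 0 y :> 'M_(2, 1 + 1).
  move=> Av Aw; rewrite mul_mx_row mul_row_block !mulmx0 addr0 add0r Av Aw.
  by rewrite {2}[x]mx11_scalar {2}[y]mx11_scalar !mul_mx_scalar.
apply: glue.
  rewrite -scalemxAr -ts // scalerA mulrC.
  by congr (_ *: _); apply: esym; apply: (line_factor_trans (q.1 : vidx L) pz1).
rewrite -scalemxAr -tt // scalerA mulrC.
by congr (_ *: _); apply: esym; apply: (line_factor_trans (q.2 : vidx M) pz2).
Qed.
End Isomorphisms.

(** * Sections that vanish on lines of both rulings *)

Section Splitting.
Variable K : closedFieldType.
Notation Q := (quadric K).
Notation P1 := (pspace K 1).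

Lemma bilinear_formD (F G : Q -> K) c d : bilinear_form F -> bilinear_form G ->
  bilinear_form (fun z => c * F z + d * G z).
Proof. by move=> [F1 F2] [G1 G2]; split=> p; apply: linear_formD. Qed.

Lemma bilinear_form_prod (f g : P1 -> K) : linear_form f -> linear_form g ->
  bilinear_form (fun z => f z.1 * g z.2).
Proof.
move=> lf lg; split=> [x|y].
  by have := linear_formD (f x) 0 lg lg; apply: linear_form_ext => p /=; rewrite mul0r addr0.
by have := linear_formD (g y) 0 lf lf; apply: linear_form_ext => p /=; rewrite mul0r addr0 mulrC.
Qed.

(** Linear forms in a single variable can be cancelled while the other variable
    is fixed, by [linear_form_mul_eq0]. *)
Lemma bilinear_form_mul_eq0 (F : Q -> K) (f g : P1 -> K) : bilinear_form F ->
  linear_form f -> linear_form g -> (exists p, f p != 0) -> (exists p, g p != 0) ->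
  (forall x y, f x * g y * F (x, y) = 0) -> forall z, F z = 0.
Proof.
move=> [F1 F2] lf lg f0 g0 fgF [x y].
apply: (linear_form_mul_eq0 (F1 x) lg _ g0 y) => {}y.
apply/eqP; rewrite mulf_eq0 orbC; have [//|gy /=] := eqVneq (g y) 0.
apply/eqP; apply: (linear_form_mul_eq0 (F2 y) lf _ f0 x) => {}x.
apply: (mulIf gy); rewrite mul0r -(fgF x y); ring.
Qed.

Variable E : vbundle Q 2.
Variable delta : vidx E -> Q -> K.
Hypothesis deltaP : det_frame delta.
Hypothesis Egg : globally_generated E.
Notation section := (vidx E -> Q -> 'cV[K]_2).
Notation wedge := (wedge delta).
Implicit Types (s t u v r : section).

(** Since the global sections generate E, this says that the value of s at z is
    zero, in terms of bilinear forms only. *)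
Definition vanishes_at s z : Prop := forall u, global_section u -> wedge s u z = 0.

Definition nonzero s : Prop := exists u z, global_section u /\ wedge s u z != 0.

Let bil s t : global_section s -> global_section t -> bilinear_form (wedge s t).
Proof. exact: wedge_bilinear. Qed.

Section TwoSections.
Variables (s t : section) (a b : P1).
Hypotheses (gs : global_section s) (gt : global_section t).
Hypotheses (s0 : nonzero s) (t0 : nonzero t).
Hypothesis s_a : forall y, vanishes_at s (a, y).
Hypothesis t_b : forall x, vanishes_at t (x, b).

(** For fixed y the wedge product of s and u is a linear form in x with root a. *)
Lemma factor_ell_a : exists be : section -> P1 -> K, forall u, global_section u ->
  linear_form (be u) /\ forall x y, wedge s u (x, y) = ell a x * be u y.
Proof.
have [a' a'0] := ell_neq0 a.
exists (fun u y => (ell a a')^-1 * wedge s u (a', y)) => u gu; split.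
  have [/(_ a') l _] := bil gs gu.
  have := linear_formD (ell a a')^-1 0 l l.
  by apply: linear_form_ext => p; rewrite mul0r addr0.
move=> x y; have [_ /(_ y) l] := bil gs gu.
have [c cE] := linear_form_root l (s_a y gu).
by rewrite !cE; field.
Qed.

Lemma factor_ell_b : exists al : section -> P1 -> K, forall u, global_section u ->
  linear_form (al u) /\ forall x y, wedge t u (x, y) = al u x * ell b y.
Proof.
have [b' b'0] := ell_neq0 b.
exists (fun u x => (ell b b')^-1 * wedge t u (x, b')) => u gu; split.
  have [_ /(_ b') l] := bil gt gu.
  have := linear_formD (ell b b')^-1 0 l l.
  by apply: linear_form_ext => p; rewrite mul0r addr0.
move=> x y; have [/(_ x) l _] := bil gt gu.
have [c cE] := linear_form_root l (t_b x gu).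
by rewrite !cE; field.
Qed.

(** The wedge of s and t is l_a l_b up to a constant c.  The two cases c <> 0
    and c = 0 give the two splitting types O(1,0) + O(0,1) and O(1,1) + O.  In
    each of them a divided section is defined by its wedge products, using
    [section_of_functional]; the Plucker relation for the quotients follows from
    the one for s or t by cancelling linear forms. *)
Lemma splits_of_two_rulings : splits E.
Proof.
have [be beP] := factor_ell_a; have [al alP] := factor_ell_b.
have lbe u (gu : global_section u) := proj1 (beP u gu).
have lal u (gu : global_section u) := proj1 (alP u gu).
have sE u x y (gu : global_section u) : wedge s u (x, y) = ell a x * be u y.
  by have [_] := beP u gu.
have tE u x y (gu : global_section u) : wedge t u (x, y) = al u x * ell b y.
  by have [_] := alP u gu.
have [a' a'0] := ell_neq0 a; have [b' b'0] := ell_neq0 b.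
have betb : be t b = 0.
  apply: (mulfI a'0); rewrite -sE // mulr0 wedgeC.
  by rewrite (t_b a' gs) oppr0.
have [c betE] := linear_form_root (lbe t gt) betb.
have cancel_ell (f g : K) x y : ell a x * ell b y * f = ell a x * ell b y * g ->
    ell a x != 0 -> ell b y != 0 -> f = g.
  by move=> fg ax bY; apply: (mulfI (mulf_neq0 ax bY)).
have [c0|c0] := eqVneq c 0; last first.
  (* E = O(1,0) + O(0,1), by the sections sg = s / l_a and ta = t / l_b. *)
  have [sg [hsg sgE]] : exists sg, twisted_section (-1) 0 sg /\
      forall u z, global_section u -> wedge sg u z = be u z.2.
    apply: (section_of_functional deltaP Egg (lam := fun u z => be u z.2)).
      by move=> u gu; rewrite addrN addr0; apply: bireg_ylinear (lbe u gu).
    move=> u v r [x y] gu gv gr /=.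
    pose D p := be r y * wedge u v (p, y) + (-1) *
      (be v y * wedge u r (p, y) + (- be u y) * wedge v r (p, y)).
    have DE : forall p, D p = 0.
      apply: (@linear_form_mul_eq0 _ _ (ell a)); [|exact: ell_linear| |by exists a'].
        have [_ /(_ y) l1] := bil gu gv; have [_ /(_ y) l2] := bil gu gr.
        have [_ /(_ y) l3] := bil gv gr.
        by apply: linear_formD => //; apply: linear_formD.
      move=> p; have := wedge_plucker delta s r u v (p, y).
      by rewrite !sE // [wedge r v _]wedgeC [wedge r u _]wedgeC /D => H; ring: H.
    by apply/eqP; rewrite -subr_eq0 -(DE x) /D; apply/eqP; ring.
  have [ta [hta taE]] : exists ta, twisted_section 0 (-1) ta /\
      forall u z, global_section u -> wedge ta u z = al u z.1.
    apply: (section_of_functional deltaP Egg (lam := fun u z => al u z.1)).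
      by move=> u gu; rewrite addrN addr0; apply: bireg_xlinear (lal u gu).
    move=> u v r [x y] gu gv gr /=.
    pose D p := al r x * wedge u v (x, p) + (-1) *
      (al v x * wedge u r (x, p) + (- al u x) * wedge v r (x, p)).
    have DE : forall p, D p = 0.
      apply: (@linear_form_mul_eq0 _ _ (ell b)); [|exact: ell_linear| |by exists b'].
        have [/(_ x) l1 _] := bil gu gv; have [/(_ x) l2 _] := bil gu gr.
        have [/(_ x) l3 _] := bil gv gr.
        by apply: linear_formD => //; apply: linear_formD.
      move=> p; have := wedge_plucker delta t r u v (x, p).
      by rewrite !tE // [wedge r v _]wedgeC [wedge r u _]wedgeC /D => H; ring: H.
    by apply/eqP; rewrite -subr_eq0 -(DE y) /D; apply/eqP; ring.
  (* The wedge of sg and ta is constant, and away from the two lines it is c. *)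
  apply: (splits_of_sections deltaP hsg hta) => z.
  have := bireg_wedge deltaP hsg hta; rewrite addr0 add0r addrN => /bireg_global_const rc.
  rewrite (rc z (a', b')); have [u [v [gu gv uv0]]] := wedge_neq0_ex deltaP Egg (a', b').
  suff -> : wedge sg ta (a', b') = c by [].
  apply: (mulIf uv0); rewrite wedge_plucker !sgE // !taE //=.
  apply: (cancel_ell _ _ a' b' _ a'0 b'0).
  transitivity (wedge s t (a', b') * wedge u v (a', b')).
    by rewrite wedge_plucker !sE // !tE //; ring.
  by rewrite sE // betE; ring.
(* E = O(1,1) + O, by the section sg = s / (l_a be_u0) and a global section. *)
have st z : wedge s t z = 0 by case: z => x y; rewrite sE // betE c0 mul0r mulr0.
have [u0 [[x0 y0] [gu0 su0]]] := s0; have [u1 [[x1 y1] [gu1 tu1]]] := t0.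
have b00 : be u0 y0 != 0 by apply: contraNneq su0 => h; rewrite sE // h mulr0.
have a11 : al u1 x1 != 0 by apply: contraNneq tu1 => h; rewrite tE // h mul0r.
(* s and t are proportional at each point: the Plucker relation for s, t, u0, u
   separates the two sets of variables in [be u y] and [al u x]. *)
have G u x y (gu : global_section u) : be u0 y * al u x = be u y * al u0 x.
  pose D (z : Q) := 1 * (al u z.1 * be u0 z.2) + (-1) * (al u0 z.1 * be u z.2).
  have DE : forall z, D z = 0.
    apply: (@bilinear_form_mul_eq0 D (ell a) (ell b)); try exact: ell_linear.
    - by apply: bilinear_formD; apply: bilinear_form_prod; auto.
    - by exists a'.
    - by exists b'.
    move=> {}x {}y; have := wedge_plucker delta s t u0 u (x, y).
    by rewrite st mul0r !sE // !tE // /D /= => H; rewrite [RHS]H; ring.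
  by apply/eqP; rewrite -subr_eq0 -(DE (x, y)) /D; apply/eqP => /=; ring.
have a01 : al u0 x1 != 0.
  by apply: contraTneq (mulf_neq0 b00 a11) => h; rewrite G // h mulr0 eqxx.
pose cu u := al u x1 / al u0 x1.
have beE u y (gu : global_section u) : be u y = be u0 y * cu u.
  by rewrite /cu mulrA G // mulfK.
have [sg [hsg sgE]] : exists sg, twisted_section (-1) (-1) sg /\
    forall u z, global_section u -> wedge sg u z = cu u.
  apply: (section_of_functional deltaP Egg (lam := fun u z => cu u)).
    by move=> u gu; rewrite addrN; apply: bireg_const.
  move=> u v r z gu gv gr /=.
  pose D z := cu r * wedge u v z + (-1) *
      (cu v * wedge u r z + (- cu u) * wedge v r z).
  have DE : forall z, D z = 0.
    apply: (@bilinear_form_mul_eq0 D (ell a) (be u0)); try exact: ell_linear.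
    - by apply: bilinear_formD; [|apply: bilinear_formD]; apply: bil.
    - exact: lbe.
    - by exists a'.
    - by exists y0.
    move=> x y; have := wedge_plucker delta s r u v (x, y).
    rewrite !sE // (beE u) // (beE v) // (beE r) //.
    by rewrite [wedge r v _]wedgeC [wedge r u _]wedgeC /D => H; ring: H.
  by apply/eqP; rewrite -subr_eq0 -(DE z) /D; apply/eqP; ring.
apply: (splits_of_sections deltaP hsg (twisted_of_global gu0)) => z.
by rewrite sgE // /cu divff // oner_eq0.
Qed.
End TwoSections.
End Splitting.

(** * Generation by three sections *)

Section ThreeSections.
Variable K : closedFieldType.
Notation Q := (quadric K).
Notation P1 := (pspace K 1).

(** The hypothesis is the vanishing of the determinant of the two forms. *)
Lemma linear_form_common_root (f g : P1 -> K) : linear_form f -> linear_form g ->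
  f (affine0 0) * g (affine1 0) = f (affine1 0) * g (affine0 0) ->
  exists p, f p = 0 /\ g p = 0.
Proof.
move=> [c [d fE]] [c' [d' gE]].
have [E0 E1] := affine0E (0 : K); have [E2 E3] := affine1E (0 : K).
rewrite !fE !gE E0 E1 E2 E3 !mulr0 !mulr1 !addr0 !add0r => D.
have [n|] := boolP ((d != 0) || (- c != 0)).
  exists (point n); rewrite fE gE; have [-> ->] := pointE n.
  by split; ring: D.
rewrite negb_or !negbK oppr_eq0 => /andP[/eqP d0 /eqP c0].
have [n|] := boolP ((d' != 0) || (- c' != 0)).
  exists (point n); rewrite fE gE; have [-> ->] := pointE n.
  by rewrite c0 d0; split; ring.
rewrite negb_or !negbK oppr_eq0 => /andP[/eqP d'0 /eqP c'0].
by exists (affine0 0); rewrite fE gE c0 d0 c'0 d'0; split; ring.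
Qed.

(** Two curves of bidegree (1,1) meet.  Some x makes the two linear forms
    F (x, .) and G (x, .) dependent, and then they have a common root. *)
Lemma bilinear_form_common_root (F G : Q -> K) : bilinear_form F -> bilinear_form G ->
  exists z, F z = 0 /\ G z = 0.
Proof.
move=> [F1 F2] [G1 G2].
pose e0 := affine0 (0 : K); pose e1 := affine1 (0 : K).
suff [x xE] : exists x, F (x, e0) * G (x, e1) = F (x, e1) * G (x, e0).
  by have [y yE] := linear_form_common_root (F1 x) (G1 x) xE; exists (x, y).
have [a [b F0E]] := F2 e0; have [c [d F1E]] := F2 e1.
have [a' [b' G0E]] := G2 e0; have [c' [d' G1E]] := G2 e1.
(* The resultant of F (x, .) and G (x, .) is a quadratic form in x; p is its
   restriction to x = (1, t).  If p has no root, it is constant, its coefficient of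
   degree 2 is zero and (0, 1) is a root of the resultant. *)
pose p : {poly K} :=
  (a%:P + b *: 'X) * (c'%:P + d' *: 'X) - (c%:P + d *: 'X) * (a'%:P + b' *: 'X).
have [/closed_rootP[t /eqP]|p1] := boolP (size p != 1%N).
  rewrite !hornerE => pt; exists (affine0 t); rewrite F0E F1E G0E G1E.
  have [-> ->] := affine0E t; apply/eqP.
  by rewrite -subr_eq0 -[X in _ == X]pt; apply/eqP; ring.
exists e1; rewrite F0E F1E G0E G1E /e1; have [-> ->] := affine1E (0 : K).
have : p`_2 = 0 by apply: nth_default; move/negPn/eqP: p1 => ->.
have -> : p = (a * c' - c * a')%:P + (a * d' + b * c' - c * b' - d * a') *: 'X
              + (b * d' - d * b') *: 'X^2.
  by rewrite /p -!mul_polyC; rewrite !(rmorphB, rmorphD, rmorphM) /=; ring.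
rewrite !(coefD, coefZ, coefC, coefX, coefXn) /= mulr0 !add0r => H.
by apply/eqP; rewrite -subr_eq0; apply/eqP; rewrite -[RHS]H; ring.
Qed.

Variable E : vbundle Q 2.
Variable delta : vidx E -> Q -> K.
Hypothesis deltaP : det_frame delta.
Hypothesis Egg : globally_generated E.
Notation section := (vidx E -> Q -> 'cV[K]_2).
Notation wedge := (wedge delta).
Notation vanishes_at := (vanishes_at delta).
Notation nonzero := (nonzero delta).
Implicit Types (s t u v r w : section).

Lemma zero_section s : ~ nonzero s -> forall z, vanishes_at s z.
Proof.
move=> ns z u gu; apply/eqP; apply: contraT => suz; case: ns.
by exists u, z.
Qed.

(** Here phi parametrises a line of either ruling.  On this line the wedge of s
    and t is a linear form with a double root at p0, hence zero; and their wedges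
    with a section u are linear forms with the root p0, hence proportional, which
    tells the combination that vanishes. *)
Lemma vanishing_on_ruling (phi : P1 -> Q) p0 s t :
  (forall F, bilinear_form F -> linear_form (fun p => F (phi p))) ->
  global_section s -> global_section t ->
  vanishes_at s (phi p0) -> vanishes_at t (phi p0) -> nonzero s ->
  (forall c, nonzero (comb 1 t (- c) s)) ->
  exists w, [/\ global_section w, nonzero w & forall p, vanishes_at w (phi p)].
Proof.
move=> lphi gs gt sv tv s0 ti.
have lw q r : global_section q -> global_section r -> linear_form (fun p => wedge q r (phi p)).
  by move=> gq gr; apply/lphi/wedge_bilinear.
have [[p1 [u [gu su]]]|sz] :=
  classic (exists p1 u, global_section u /\ wedge s u (phi p1) != 0); last first.
  exists s; split=> // p u gu; apply/eqP; apply: contraT => su.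
  by case: sz; exists p, u.
have [c sE] := linear_form_root (lw s u gs gu) (sv u gu).
have [d tE] := linear_form_root (lw t u gt gu) (tv u gu).
have c0 : c != 0 by apply: contraNneq su => c0; rewrite sE c0 mul0r.
(* Both wedge products with u vanish at p0 only, so a combination w of s and t has
   wedge 0 with u along the whole line; there it also has wedge 0 with s. *)
pose w := comb 1 t (- (d / c)) s.
have gw : global_section w by apply: global_section_comb.
have wu p : wedge w u (phi p) = 0.
  by rewrite /w wedge_comb sE tE; field.
have [a [b [ga gb ab0]]] := wedge_neq0_ex deltaP Egg (phi p0).
(* The product of the wedges of s, t and of a frame a, b at p0 vanishes doubly at
   p0, by the Plucker relation, and the second factor does not vanish there. *)
have st0 : forall p, wedge s t (phi p) = 0.
  have [x1 s1] := linear_form_root (lw s a gs ga) (sv a ga).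
  have [x2 s2] := linear_form_root (lw t b gt gb) (tv b gb).
  have [x3 s3] := linear_form_root (lw s b gs gb) (sv b gb).
  have [x4 s4] := linear_form_root (lw t a gt ga) (tv a ga).
  apply: (linear_form_double_root (lw s t gs gt) (lw a b ga gb) (sv t gt) ab0
           (c := x1 * x2 - x3 * x4)).
  by move=> p; rewrite wedge_plucker s1 s2 s3 s4; ring.
exists w; split=> [//||p r gr]; first exact: ti.
have su1 : exists p, wedge s u (phi p) != 0 by exists p1.
suff prod0 q : wedge w r (phi q) * wedge s u (phi q) = 0.
  exact: (linear_form_mul_eq0 (lw w r gw gr) (lw s u gs gu) prod0 su1).
rewrite wedge_plucker wu mul0r subr0 /w wedge_comb wedgess mulr0 addr0 mul1r.
by rewrite wedgeC st0 oppr0 mul0r.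
Qed.

(** Two independent sections vanishing at z would give nonzero sections
    vanishing on both lines through z, and E would split. *)
Lemma section_vanishing_unique z s t : ~ splits E ->
  global_section s -> global_section t -> vanishes_at s z -> vanishes_at t z ->
  nonzero s -> exists c, forall y, vanishes_at (comb 1 t (- c) s) y.
Proof.
case: z => x y nsp gs gt sv tv s0; apply: NNPP => H; apply: nsp.
have ti c : nonzero (comb 1 t (- c) s).
  by apply: NNPP => nz; apply: H; exists c; apply: zero_section.
have [w1 [gw1 w10 w1v]] : exists w,
    [/\ global_section w, nonzero w & forall p, vanishes_at w (x, p)].
  by apply: (@vanishing_on_ruling (fun p => (x, p)) y s t) => // F [].
have [w2 [gw2 w20 w2v]] : exists w,
    [/\ global_section w, nonzero w & forall p, vanishes_at w (p, y)].
  by apply: (@vanishing_on_ruling (fun p => (p, y)) x s t) => // F [].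
exact: (splits_of_two_rulings deltaP Egg gw1 gw2 w10 w20 w1v w2v).
Qed.

(** Two sections u, v generate E at some point z0, and the global sections that
    vanish at z0 form a space of dimension at most 1, spanned by s.  That s spans
    with u and v is expressed through the wedge products. *)
Lemma three_sections : ~ splits E -> exists u v s,
  [/\ global_section u, global_section v, global_section s &
   forall w, global_section w -> exists a b c, forall r z, global_section r ->
     wedge w r z = a * wedge u r z + b * wedge v r z + c * wedge s r z].
Proof.
move=> nsp; pose z0 : Q := (affine0 0, affine0 0).
have [u [v [gu gv uv0]]] := wedge_neq0_ex deltaP Egg z0.
(* [red w] is w minus the combination of u and v that has the same value at z0. *)
pose al w := wedge w v z0 / wedge u v z0; pose be w := wedge u w z0 / wedge u v z0.
pose red w := comb 1 w (-1) (comb (al w) u (be w) v).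
have redE w r z : wedge (red w) r z = wedge w r z - al w * wedge u r z - be w * wedge v r z.
  by rewrite /red !wedge_comb; ring.
have gred w : global_section w -> global_section (red w).
  by move=> gw; do 2?apply: global_section_comb.
have red0 w : vanishes_at (red w) z0.
  move=> r _; rewrite redE /al /be; have H := wedge_plucker delta w r u v z0.
  apply: (mulIf uv0); rewrite mul0r !mulrBl H.
  rewrite [wedge r v _]wedgeC [wedge r u _]wedgeC [wedge w u _]wedgeC.
  by field.
(* If all [red w] were zero, u and v would span the global sections, which cannot
   generate E at a zero z1 of the wedge of u and v. *)
have [z1 [uv1 _]] :=
  bilinear_form_common_root (wedge_bilinear deltaP gu gv) (wedge_bilinear deltaP gu gv).
have [w1 [w2 [g1 g2 w12]]] := wedge_neq0_ex deltaP Egg z1.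
have [s0 [gs0 ns0]] : exists s0, global_section s0 /\ nonzero (red s0).
  apply: NNPP => H.
  have rz w : global_section w -> forall r z, global_section r ->
      wedge w r z = al w * wedge u r z + be w * wedge v r z.
    move=> gw r z gr; have nz : ~ nonzero (red w) by move=> nz; apply: H; exists w.
    have := zero_section nz z gr; rewrite redE => /eqP; rewrite -addrA -opprD subr_eq0.
    by move/eqP.
  move: w12; rewrite (rz w1) // [wedge u w2 _]wedgeC [wedge v w2 _]wedgeC !(rz w2) //.
  by rewrite !wedgess [wedge v u _]wedgeC uv1 !(mulr0, oppr0, addr0) eqxx.
exists u, v, (red s0); split=> //; first exact: gred.
move=> w gw; have [c cE] :=
  section_vanishing_unique nsp (gred _ gs0) (gred _ gw) (red0 _) (red0 _) ns0.
exists (al w), (be w), c => r z gr; have := cE z r gr; rewrite wedge_comb redE => H.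
by apply/eqP; rewrite -subr_eq0; apply/eqP; rewrite -[RHS]H; ring.
Qed.

End ThreeSections.

(** * Projection from a point and the Euler sequence *)

Section EulerSequence.
Variable K : closedFieldType.
Notation Q := (quadric K).
Notation P1 := (pspace K 1).

Lemma bilinear_form_coord (F : Q -> K) : bilinear_form F ->
  exists c : 'cV[K]_4, forall z : Q, F z = ((hcoord z : 'rV_4) *m c) ord0 ord0.
Proof.
move=> [F1 F2]; pose e k := if k == ord0 :> 'I_2 then affine0 (0 : K) else affine1 0.
exists (mxvec (\matrix_(i < 2, j < 2) F (e i, e j)))^T => -[x y].
rewrite [_ *m _](mxvec_dotmul (\matrix_(i < 2, j < 2) F (e i, e j)) (hcoord x) (hcoord y)).
have lE (f : P1 -> K) p : linear_form f ->
    f p = \sum_(k < 2) hcoord p ord0 (k : 'I_2) * f (e k).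
  move=> [c [d fE]]; rewrite !big_ord_recl big_ord0 addr0 /e /= !fE.
  have -> : lift ord0 (ord0 : 'I_1) = ord_max :> 'I_2 by apply: val_inj.
  have [-> ->] := affine0E (0 : K); have [-> ->] := affine1E (0 : K); ring.
rewrite (lE _ x (F2 y)) !mxE.
rewrite [RHS](eq_bigr (fun j => \sum_(i < 2)
   hcoord x ord0 (i : 'I_2) * F (e i, e j) * hcoord y ord0 (j : 'I_2))); last first.
  by move=> j _; rewrite !mxE big_distrl; apply: eq_bigr => i _; rewrite mxE.
rewrite exchange_big /=; apply: eq_bigr => i _.
rewrite (lE _ y (F1 (e i))) big_distrr /=; apply: eq_bigr => j _; ring.
Qed.

(** If the linear map A on K^4 kills P, it factors through the projection from
    P; this is the matrix of the factor in the coordinates of [proj_coord]. *)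
Definition proj_factor (P : pspace K 3) (A : 'M[K]_(4, 3)) : 'M[K]_3 :=
  ((hcoord P : 'rV_4) ord0 (pivot P))^-1 *: row' (pivot P) A.

Lemma proj_factorE (P : pspace K 3) (A : 'M[K]_(4, 3)) (x : 'rV[K]_4) :
  (hcoord P : 'rV_4) *m A = 0 -> x *m A = proj_coord P x *m proj_factor P A.
Proof.
set i := pivot P; set y : 'rV[K]_4 := hcoord P.
have yi : y ord0 i != 0 := xchooseP (pspace_cover P).
move=> yA; apply/matrixP => o l; have {o}-> : o = ord0 by rewrite [o]ord1 [ord0]ord1.
rewrite !mxE (bigD1_ord i) //=.
have : (y *m A) ord0 l = 0 by rewrite yA mxE.
rewrite mxE (bigD1_ord i) //= => /eqP; rewrite addrC addr_eq0 => /eqP yE.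
transitivity (\sum_(k < 3) (x ord0 (lift i k) * A (lift i k) l) -
   x ord0 i / y ord0 i * \sum_(k < 3) (y ord0 (lift i k) * A (lift i k) l)).
  by rewrite yE; field.
rewrite big_distrr -sumrB; apply: eq_bigr => k _.
by rewrite !mxE -/i -/y /=; field.
Qed.

Lemma unitmx_of_kernel n (C : 'M[K]_n) :
  (forall c : 'cV[K]_n, C *m c = 0 -> c = 0) -> C \in unitmx.
Proof.
move=> C0; rewrite -unitmx_tr -row_free_unit -kermx_eq0; apply/rowV0P => v /sub_kermxP vC.
apply: (can_inj (@trmxK _ _ _)); rewrite trmx0; apply: C0.
by rewrite -[C]trmxK -trmx_mul vC trmx0.
Qed.

(** The Euler map from the trivial bundle of rank 3 to TP^2(-1) at the point p,
    in the charts a.1 of TP^2 and a.2 of O(-1): a vector e is sent to the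
    derivative along e of the affine coordinates p_k / p_(a.1), multiplied by
    p_(a.2) to trivialise the twist. *)
Definition euler_mx (p : 'rV[K]_3) (a : 'I_3 * 'I_3) : 'M[K]_(2, 3) :=
  \matrix_(k, e) (p ord0 a.2 *
    ((lift a.1 k == e)%:R * p ord0 a.1 - p ord0 (lift a.1 k) * (a.1 == e)%:R)
    / p ord0 a.1 ^+ 2).

(** The columns of [euler_mx] of index other than b.1 are, in the chart b, a
    multiple of the standard basis, so that they give the transition matrix when
    they are written in the chart a. *)
Lemma euler_trans (p : pspace K 2) (a b : 'I_3 * 'I_3) :
  hcoord p ord0 a.1 != 0 -> hcoord p ord0 a.2 != 0 ->
  hcoord p ord0 b.1 != 0 -> hcoord p ord0 b.2 != 0 ->
  vtrans (vtwist (ptangent K 2) (pline K 2 (-1))) a b p =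
  (hcoord p ord0 b.1 / hcoord p ord0 b.2) *: colsub (lift b.1) (euler_mx (hcoord p) a).
Proof.
move=> a1 a2 b1 b2; apply/matrixP => k l.
rewrite mxE [in X in X * _]/= pjacobianE // !mxE /= mulr1n exprN1.
move: a1 a2 b1 b2 => /= a1 a2 b1 b2.
by field; rewrite a1 a2 b2.
Qed.

(** The Euler map is onto with kernel spanned by p, so a matrix that kills p
    factors through it; the factor is read off on the columns other than a.1. *)
Lemma euler_mxP (p : 'rV[K]_3) (a : 'I_3 * 'I_3) (M : 'M[K]_(2, 3)) :
  p ord0 a.1 != 0 -> p ord0 a.2 != 0 -> M *m p^T = 0 ->
  ((p ord0 a.1 / p ord0 a.2) *: colsub (lift a.1) M) *m euler_mx p a = M.
Proof.
move=> a1 a2 Mp; apply/matrixP => k e; rewrite mxE.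
have : (M *m p^T) k ord0 = 0 by rewrite Mp mxE.
rewrite mxE (bigD1_ord a.1) //= mxE => /eqP; rewrite addrC addr_eq0 => /eqP Mk.
have [->|[l ->]] : e = a.1 \/ exists l, e = lift a.1 l.
  by case: (unliftP a.1 e) => [l ->|->]; [right; exists l|left].
  apply: (mulIf a1); rewrite -[RHS]opprK -Mk big_distrl -sumrN /=; apply: eq_bigr => l _.
  rewrite !mxE eqxx eq_sym (negPf (neq_lift _ _)) mulr0n mulr1n.
  by field; rewrite a1 a2.
rewrite (bigD1 l) //= big1 ?addr0 => [|l' l'l].
  by rewrite !mxE eqxx (negPf (neq_lift _ _)) mulr0n mulr1n; field; rewrite a1 a2.
rewrite !mxE (inj_eq lift_inj) (negPf l'l) (negPf (neq_lift _ _)) mulr0n; ring.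
Qed.

End EulerSequence.

(** * The projection defined by three sections *)

Section Projection.
Variable K : closedFieldType.
Notation Q := (quadric K).
Variable E : vbundle Q 2.
Variable delta : vidx E -> Q -> K.
Hypothesis deltaP : det_frame delta.
Hypothesis Egg : globally_generated E.
Notation section := (vidx E -> Q -> 'cV[K]_2).
Notation wedge := (wedge delta).

Variables u v s : section.
Hypotheses (gu : global_section u) (gv : global_section v) (gs : global_section s).
Hypothesis span : forall w, global_section w -> exists a b c,
  forall r z, global_section r ->
    wedge w r z = a * wedge u r z + b * wedge v r z + c * wedge s r z.

Definition frame i z : 'M[K]_(2, 3) := \matrix_(k, l) [:: u i z; v i z; s i z]`_l k ord0.

(** The signed minors of [frame], in the trivialisation of det E; they are the
    coefficients of the linear relation between the three sections. *)
Definition minors z : 'rV[K]_3 := \row_l [:: wedge v s z; wedge s u z; wedge u v z]`_l.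

Lemma frame_minors i z : vdom E i z -> frame i z *m (minors z)^T = 0.
Proof.
move=> iz; apply/matrixP => k o; rewrite !mxE !big_ord_recl big_ord0 !mxE /= addr0.
have [[gu' gv'] gs'] := (twisted_of_global gu, twisted_of_global gv, twisted_of_global gs).
rewrite (wedgeE deltaP gv' gs' iz) (wedgeE deltaP gs' gu' iz) (wedgeE deltaP gu' gv' iz).
by have [->|->] := ord2P k; rewrite /det2; ring.
Qed.

(** At a common zero of the minors the span of u, v, s has rank at most 1, while
    it contains all global sections. *)
Lemma minors_neq0 z : minors z != 0.
Proof.
have [w1 [w2 [g1 g2 w12]]] := wedge_neq0_ex deltaP Egg z.
apply: contraNneq w12 => /rowP m0.
have := m0 (inord 0); have := m0 (inord 1); have := m0 (inord 2).
rewrite !mxE !inordK //= => uv su vs.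
have [a [b [c w1E]]] := span g1; have [a' [b' [c' w2E]]] := span g2.
rewrite w1E // [wedge u w2 _]wedgeC [wedge v w2 _]wedgeC [wedge s w2 _]wedgeC !w2E // !wedgess.
rewrite [wedge v u _]wedgeC [wedge u s _]wedgeC [wedge s v _]wedgeC uv su vs.
by apply/eqP; ring.
Qed.

Lemma minors_bilinear l : bilinear_form (fun z => minors z ord0 l).
Proof.
have ext (F G : Q -> K) : (forall z, F z = G z) -> bilinear_form F -> bilinear_form G.
  move=> FG [F1 F2].
  by split=> p; [apply: linear_form_ext (F1 p)|apply: linear_form_ext (F2 p)].
case: l => [[|[|[|//]]] hl].
- by apply: ext (wedge_bilinear deltaP gv gs) => z; rewrite mxE.
- by apply: ext (wedge_bilinear deltaP gs gu) => z; rewrite mxE.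
- by apply: ext (wedge_bilinear deltaP gu gv) => z; rewrite mxE.
Qed.

(** A linear relation would express one of the minors through the two others,
    which have a common zero. *)
Lemma minors_independent (c : 'cV[K]_3) : (forall z, minors z *m c = 0) -> c = 0.
Proof.
move=> mc; apply/matrixP => l o; rewrite (ord1 o) [RHS]mxE {o}; apply/eqP; apply: contraT => cl.
have [z [z0 z1]] := bilinear_form_common_root
  (minors_bilinear (lift l (ord0 : 'I_2))) (minors_bilinear (lift l (ord_max : 'I_2))).
have : (minors z *m c) ord0 0 = 0 by rewrite mc mxE.
rewrite mxE (bigD1_ord l) //= big1 ?addr0 => [/eqP|k _]; last first.
  by have [->|->] := ord2P k; rewrite ?z0 ?z1 mul0r.
rewrite mulf_eq0 (negPf cl) orbF => /eqP zl.
have := minors_neq0 z; suff -> : minors z = 0 by rewrite eqxx.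
apply/matrixP => o k; have {o}-> : o = ord0 by rewrite [o]ord1 [ord0]ord1.
rewrite [RHS]mxE; case: (unliftP l k) => [j ->|-> //].
by have [->|->] := ord2P j.
Qed.

Lemma minors_linear : exists A : 'M[K]_(4, 3),
  forall z : Q, minors z = (hcoord z : 'rV_4) *m A.
Proof.
pose coordP l := bilinear_form_coord (minors_bilinear l).
pose c l := proj1_sig (constructive_indefinite_description _ (coordP l)).
have cE l z : minors z ord0 l = ((hcoord z : 'rV_4) *m c l) ord0 ord0.
  exact: (proj2_sig (constructive_indefinite_description _ (coordP l))).
exists (\matrix_(k, l) c l k ord0) => z.
apply/matrixP => o l; have {o}-> : o = ord0 by rewrite [o]ord1 [ord0]ord1.
by rewrite cE !mxE; apply: eq_bigr => k _; rewrite mxE.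
Qed.

(** The minors define a linear map from K^4 to K^3; P is a vector in its kernel.
    It is not on the quadric, where the minors have no common zero, and the
    minors are the coordinates of the projection from P up to a matrix that is
    invertible because they are independent. *)
Lemma minors_projection :
  exists (P : pspace K 3) (offP : off_quadric P) (C : 'M[K]_3),
  C \in unitmx /\ forall z, minors z = hcoord (proj_fun offP z) *m C.
Proof.
have [A AE] := minors_linear.
have : kermx A != 0.
  by rewrite kermx_eq0 /row_free; apply: contraTneq (rank_leq_col A) => ->.
case/rowV0Pn => y /sub_kermxP yA y0.
pose P : pspace K 3 := exist (fun w : 'rV[K]_4 => w != 0) y y0.
have offP : off_quadric P.
  move=> z c zE; have := minors_neq0 z; rewrite AE.
  by rewrite (_ : (hcoord z : 'rV_4) = c *: y) // -scalemxAl yA scaler0 eqxx.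
exists P, offP, (proj_factor P A).
have mE z : minors z = hcoord (proj_fun offP z) *m proj_factor P A.
  by rewrite AE (proj_factorE (P := P)).
split=> //; apply: unitmx_of_kernel => c Cc; apply: minors_independent => z.
by rewrite mE -mulmxA Cc mulmx0.
Qed.

(** The three sections, in the basis adapted to the projection, define a map
    from the trivial bundle of rank 3 to E that kills the coordinates of the
    projected point; by the Euler sequence it factors through the pullback of
    TP^2(-1), and the factor is invertible since the sections generate E. *)
Lemma visom_pulled_tangent : exists (P : pspace K 3) (offP : off_quadric P),
  visom E (pulled_tangent offP).
Proof.
have [P [offP [C [uC mE]]]] := minors_projection; exists P, offP.
pose p z : 'rV[K]_3 := hcoord (proj_fun offP z).
(* The columns of [M i z] are the three sections in the basis in which their
   relation is given by the coordinates p of the projected point. *)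
pose M i z := frame i z *m C^T.
have Mp i z : vdom E i z -> M i z *m (p z)^T = 0.
  by move=> iz; rewrite -mulmxA -trmx_mul -mE frame_minors.
pose k (i : vidx E) (a : vidx (pulled_tangent offP)) (z : Q) : 'M[K]_2 :=
  (p z ord0 a.1 / p z ord0 a.2) *: colsub (lift a.1) (M i z).
have kM i a z : vdom E i z -> vdom (pulled_tangent offP) a z ->
    k i a z *m euler_mx (p z) a = M i z.
  by move=> iz [a1 a2]; apply: euler_mxP => //; apply: Mp.
apply: (@visom_of_unit _ _ _ _ _ k); last first.
  move=> i a z iz az; rewrite -row_free_unit -kermx_eq0; apply/rowV0P => w /sub_kermxP wk.
  (* A row that kills [k i a z] kills u, v and s, hence all the minors. *)
  have wM : w *m frame i z = 0.
    have uCt : C^T \in unitmx by rewrite unitmx_tr.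
    by rewrite -(mulmxK uCt (frame i z)) -/(M i z) -(kM i a z iz az) !mulmxA wk !mul0mx.
  have wcol l : w *m [:: u i z; v i z; s i z]`_l = 0 :> 'M_1.
    have [l3|l3] := ltnP l 3; last by rewrite nth_default // mulmx0.
    have := congr1 (col (Ordinal l3)) wM; rewrite col0 => <-.
    rewrite colE -mulmxA -colE; congr (_ *m _); apply/matrixP => q o.
    by rewrite !mxE (ord1 o).
  have wdet (x y : 'cV[K]_2) i' : w *m x = 0 -> w *m y = 0 -> w != 0 ->
      delta i' z * det2 x y = 0.
    move=> wx wy; apply: contraNeq; rewrite mulf_eq0 negb_or => /andP[_ d0].
    have uxy : (row_mx x y : 'M_2) \in unitmx by rewrite unitmxE unitfE det2_row_mx.
    by rewrite -[w](mulmxK uxy) (mul_mx_row w x y) wx wy row_mx0 mul0mx.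
  have [[gu' gv'] gs'] := (twisted_of_global gu, twisted_of_global gv, twisted_of_global gs).
  apply/eqP; apply: contraT => w0; have := minors_neq0 z.
  suff -> : minors z = 0 by rewrite eqxx.
  have [wu [wv ws]] := (wcol 0%N, (wcol 1%N, wcol 2%N)).
  apply/rowP => l; rewrite !mxE (wedgeE deltaP gv' gs' iz) (wedgeE deltaP gs' gu' iz).
  by rewrite (wedgeE deltaP gu' gv' iz) !wdet //; case: l => [[|[|[|]]]].
split=> [i a q l|i j a b z iz jz az bz].
  apply: (regular_ext (f := fun z => (p z ord0 a.1 / p z ord0 a.2) *
      \sum_e frame i z q e * C^T e (lift a.1 l))).
    by move=> z _; rewrite !mxE.
  apply: regularM.
    have := locally_polynomial_regular (proj_poly offP)
      (@regular_ratio K (pspace K 2) a.1 a.2).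
    by apply: regular_sub => z [_ []].
  apply: regular_sum => e; apply: regularM; last exact: regular_const.
  apply: (regular_sub (U := vdom E i)) => [z []//|].
  case: gu gv gs => ru _ [rv _] [rs _].
  case: e => [[|[|[|//]]] e3].
  - by apply: regular_ext (ru i q ord0) => z _; rewrite mxE.
  - by apply: regular_ext (rv i q ord0) => z _; rewrite mxE.
  - by apply: regular_ext (rs i q ord0) => z _; rewrite mxE.
have [a1 a2] := az; have [b1 b2] := bz.
have trE : vtrans (pulled_tangent offP) a b z =
   (p z ord0 b.1 / p z ord0 b.2) *: colsub (lift b.1) (euler_mx (p z) a).
  exact: (euler_trans (p := proj_fun offP z)).
have frame_trans : vtrans E i j z *m frame j z = frame i z.
  case: gu gv gs => _ tu [_ tv] [_ ts]; apply/matrixP => q l.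
  rewrite [RHS]mxE (tu i j) // (tv i j) // (ts i j) // mxE.
  transitivity (\sum_e vtrans E i j z q e * [:: u j z; v j z; s j z]`_l e ord0).
    by apply: eq_bigr => e _; rewrite mxE.
  by case: l => [[|[|[|//]]] l3] /=; rewrite mxE.
rewrite trE -[RHS]scalemxAr [in RHS]mulmx_colsub kM //.
by rewrite /k -scalemxAr mulmx_colsub mulmxA frame_trans.
Qed.
End Projection.

Theorem proposition3p5 (R : realType) (E : vbundle (quadric R[i]%C) 2)
  (Egg : globally_generated E) (Ec1 : has_c1 E 1%Z 1%Z) (Ens : ~ splits E) :
  exists (P : pspace R[i]%C 3) (offP : off_quadric P),
    visom E (pulled_tangent offP).
Proof.
have [delta deltaP] := det_frame_c1 Ec1.
have [u [v [s [gu gv gs span]]]] := three_sections deltaP Egg Ens.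
exact: (visom_pulled_tangent deltaP Egg gu gv gs span).
Qed.
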